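(* Let $\mu>0$. If $s<-3/2$, then the flow map data-solution $\phi\mapsto u(t)$ for the npBO equation $$u_t+uu_x+\mathcal{H}u_{xx}+\mu(\mathcal{H}u_x+\mathcal{H}u_{xxx})=0,\quad t>0,\ x\in\mathbb{R},\qquad u(0)=\phi,$$ is not $C^2$ from $H^s(\mathbb{R})$ to $H^s(\mathbb{R})$.
   Context: $\mathcal{H}$ is the Hilbert transform, $\widehat{\mathcal{H}f}(\xi)=i\,\mathrm{sgn}(\xi)\widehat f(\xi)$, and $H^s(\mathbb{R})$ is the Sobolev space with norm $\|f\|_s=\|(1+|\xi|^2)^{s/2}\widehat f(\xi)\|_{L^2(\mathbb{R})}$. The flow map data-solution sends the initial datum $\phi$ to the solution $u(t)$, $t\in[0,T]$, for some $T>0$. Solutions are understood through the integral (Duhamel) equation $u(t)=S(t)\phi-\int_0^tS(t-\tau)[u(\tau)u_x(\tau)]\,d\tau$, where $\widehat{S(t)\phi}(\xi)=e^{(i\xi|\xi|+\mu(|\xi|-|\xi|^3))t}\,\widehat\phi(\xi)$ for $t\ge0$. *)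

(* Defs.v *)
From HB Require Import structures.
From mathcomp Require Import all_boot all_order all_algebra.
From mathcomp Require Import complex.
From mathcomp Require Import all_classical all_reals all_analysis.

Set Implicit Arguments.
Unset Strict Implicit.
Unset Printing Implicit Defensive.

Import Order.TTheory GRing.Theory Num.Theory.

Local Open Scope classical_set_scope.
Local Open Scope ring_scope.
Local Open Scope complex_scope.

(* Convention for the Fourier transform on the real line:
     f^(xi) = \int f(x) e^(- i x xi) dx,
   so that (f_x)^(xi) = i xi f^(xi) and (f g)^ = (2 pi)^-1 (f^ * g^).
   Every distribution below is an element of some H^s; its Fourier transform is
   a function, and the distribution is represented by that function, considered
   up to equality almost everywhere.  All functions [R -> R[i]] in this file are
   thus functions of the frequency variable. *)

Section FourierSide.
Context {R : realType}.
Notation mu1 := (@lebesgue_measure R).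
Implicit Types f g : R -> R[i].

Definition cmeasurable f :=
  measurable_fun setT (fun x => complex.Re (f x)) /\
  measurable_fun setT (fun x => complex.Im (f x)).

Definition cintegrable (D : set R) f :=
  mu1.-integrable D (fun x => (complex.Re (f x))%:E) /\
  mu1.-integrable D (fun x => (complex.Im (f x))%:E).

Definition cintegral (D : set R) f : R[i] :=
  (\int[mu1]_(x in D) complex.Re (f x)) +i*
  (\int[mu1]_(x in D) complex.Im (f x)).

Definition Hs_norm (s : R) f : \bar R :=
  Lnorm mu1 2%:E (fun xi =>
    ((1 + xi ^+ 2) `^ (s / 2) * ComplexField.Normc.normc (f xi))%:E).

Local Arguments Hs_norm s%_ring_scope f%_ring_scope.

(* A distribution is real-valued iff its Fourier transform is Hermitian.
   [realv = true] gives the space of real-valued distributions in H^s, and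
   [realv = false] that of all (complex-valued) ones; both are normed spaces
   over R. *)
Definition Hs (realv : bool) (s : R) : set (R -> R[i]) :=
  [set f | [/\ cmeasurable f, (Hs_norm s f < +oo)%E &
     realv -> {ae mu1, forall xi, f (- xi) = (f xi)^*}]].

Definition rscale (a : R) f : R -> R[i] := fun xi => a%:C * f xi.

Definition Hs_open realv s (D : set (R -> R[i])) :=
  D `<=` Hs realv s /\
  forall phi, D phi -> exists2 r : R, 0 < r &
    forall psi, Hs realv s psi -> (Hs_norm s (psi - phi) < r%:E)%E -> D psi.

(* Identities between elements of H^s are stated as vanishing of the norm of
   the difference, i.e. as equality almost everywhere. *)
Definition bounded_linear realv s (A : (R -> R[i]) -> (R -> R[i])) :=
  [/\ forall h, Hs realv s h -> Hs realv s (A h),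
      forall (a : R) h k, Hs realv s h -> Hs realv s k ->
        Hs_norm s (A (rscale a h + k) - (rscale a (A h) + A k)) = 0%E &
      exists C : R, forall h, Hs realv s h ->
        (Hs_norm s (A h) <= C%:E * Hs_norm s h)%E].

Definition bounded_bilinear realv s
    (B : (R -> R[i]) -> (R -> R[i]) -> (R -> R[i])) :=
  [/\ forall h, Hs realv s h -> bounded_linear realv s (B h),
      forall k, Hs realv s k -> bounded_linear realv s (B ^~ k) &
      exists C : R, forall h k, Hs realv s h -> Hs realv s k ->
        (Hs_norm s (B h k) <= C%:E * Hs_norm s h * Hs_norm s k)%E].

(* [F] maps the open set [D] of H^s to H^s and is twice continuously Frechet
   differentiable on [D]: [F1 x] is its derivative at [x], [F2 x] is the
   derivative of [F1] at [x] for the operator norm (a bounded linear map from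
   H^s to the bounded operators on H^s being the same as a bounded bilinear
   map), and [F2] is continuous for the norm of bilinear maps. *)
Definition C2_on realv s (D : set (R -> R[i]))
    (F : (R -> R[i]) -> (R -> R[i])) :=
  (forall x, D x -> Hs realv s (F x)) /\
  exists (F1 : (R -> R[i]) -> (R -> R[i]) -> (R -> R[i]))
         (F2 : (R -> R[i]) -> (R -> R[i]) -> (R -> R[i]) -> (R -> R[i])),
  [/\ forall x, D x ->
        bounded_linear realv s (F1 x) /\ bounded_bilinear realv s (F2 x),
      forall x, D x -> forall e : R, 0 < e -> exists2 d : R, 0 < d &
        forall y, D y -> (Hs_norm s (y - x) < d%:E)%E ->
        (Hs_norm s (F y - F x - F1 x (y - x)%R) <= e%:E * Hs_norm s (y - x))%E,
      forall x, D x -> forall e : R, 0 < e -> exists2 d : R, 0 < d &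
        forall y, D y -> (Hs_norm s (y - x) < d%:E)%E ->
        forall k, Hs realv s k ->
        (Hs_norm s (F1 y k - F1 x k - F2 x (y - x)%R k)
           <= e%:E * Hs_norm s (y - x) * Hs_norm s k)%E &
      forall x, D x -> forall e : R, 0 < e -> exists2 d : R, 0 < d &
        forall y, D y -> (Hs_norm s (y - x) < d%:E)%E ->
        forall h k, Hs realv s h -> Hs realv s k ->
        (Hs_norm s (F2 y h k - F2 x h k)
           <= e%:E * Hs_norm s h * Hs_norm s k)%E].

(* Multiplier of S(t): e^((i xi |xi| + mu (|xi| - |xi|^3)) t), the exponent
   coming from - H d_x^2 - mu (H d_x + H d_x^3), H having multiplier
   i sgn(xi). *)
Definition npBO_symbol (mu t : R) (xi : R) : R[i] :=
  (expR (mu * (`|xi| - `|xi| ^+ 3) * t))%:C *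
  (cos (xi * `|xi| * t) +i* sin (xi * `|xi| * t)).

Definition dx f : R -> R[i] := fun xi => (0 +i* xi) * f xi.

(* Fourier transform of the product of two distributions.  For distributions
   of negative order the product is by definition given by the convolution of
   the Fourier transforms, wherever it converges absolutely. *)
Definition product_hat_defined f g (xi : R) :=
  cintegrable setT (fun eta => f (xi - eta) * g eta).

Definition product_hat f g (xi : R) : R[i] :=
  ((2 * pi)^-1)%:C * cintegral setT (fun eta => f (xi - eta) * g eta).

(* [u tau] is the Fourier transform in space of the solution at time [tau];
   its values for tau outside [0, T] are irrelevant.  The integral
   \int_0^t S(t - tau) [u(tau) u_x(tau)] dtau is required to converge
   absolutely at almost every frequency. *)
Definition duhamel_solution realv (mu s T : R) (phi : R -> R[i])
    (u : R -> R -> R[i]) :=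
  (forall t : R, 0 <= t <= T -> Hs realv s (u t)) /\
  forall t : R, 0 <= t <= T -> {ae mu1, forall xi,
    [/\ {ae mu1, forall tau, tau \in `[0, t] ->
           product_hat_defined (u tau) (dx (u tau)) xi},
        cintegrable `[0, t] (fun tau =>
           npBO_symbol mu (t - tau) xi * product_hat (u tau) (dx (u tau)) xi) &
        u t xi = npBO_symbol mu t xi * phi xi -
          cintegral `[0, t] (fun tau =>
            npBO_symbol mu (t - tau) xi * product_hat (u tau) (dx (u tau)) xi)]}.

Definition continuous_Hs realv (s T : R) (u : R -> R -> R[i]) :=
  (forall t : R, 0 <= t <= T -> Hs realv s (u t)) /\
  forall t : R, 0 <= t <= T -> forall e : R, 0 < e -> exists2 d : R, 0 < d &
    forall t' : R, 0 <= t' <= T -> `|t' - t| < d ->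
      (Hs_norm s (u t' - u t) < e%:E)%E.

(* [Phi phi] is the solution on [0, T] with datum [phi], for [phi] in [D].
   As usual for well-posedness, the solution is the unique one in some class
   [X] of trajectories.  Of [X] it is only required that it contain the
   solutions that belong to C([0, T]; H^sigma) for all sigma. *)
Definition flow_map realv (mu s T : R) (D : set (R -> R[i]))
    (X : set (R -> R -> R[i])) (Phi : (R -> R[i]) -> R -> R -> R[i]) :=
  [/\ forall phi u, D phi -> duhamel_solution realv mu s T phi u ->
        (forall sigma : R, continuous_Hs realv sigma T u) -> X u,
      forall phi, D phi ->
        X (Phi phi) /\ duhamel_solution realv mu s T phi (Phi phi) &
      forall phi u, D phi -> X u -> duhamel_solution realv mu s T phi u ->
        forall t : R, 0 <= t <= T ->
          {ae mu1, forall xi, u t xi = Phi phi t xi}].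

End FourierSide.

(* Main.v *)
Require Import Defs.
From mathcomp Require Import all_boot all_order all_algebra.
From mathcomp Require Import complex.
From mathcomp Require Import all_classical all_reals all_analysis.
From mathcomp Require Import measurable_realfun.
From mathcomp Require Import ring lra.

(** Suppose that the flow map at time [t] is of class C^2 near [0].  Its second
    derivative at [0] is then a bounded bilinear map, and its diagonal is twice
    the second Picard iterate
      [A h = - int_0^t S(t - tau) [S(tau) h . d_x S(tau) h] dtau],
    so that [||A h||_s <= C ||h||_s ^ 2].  This bound is violated by wave
    packets [h] whose Fourier transform is a pair of bumps of fixed width around
    the frequencies [M] and [- M], as [M] tends to infinity.  Indeed [||h||_s]
    is of order [M ^ s].  On the other hand the bump at [M] interacts with the
    one at [- M] to produce frequencies of order 1, where the derivative in
    [u u_x = d_x (u ^ 2) / 2] costs nothing and where the linear flow is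
    neither small nor large.  In time this interaction decays like
    [exp (- 2 mu M ^ 3 tau)] and oscillates at the much slower rate [M ^ 2] at
    most, so that its integral over [[0, t]] is of order [M ^ -3] without any
    cancellation.  The bound would thus give [M ^ -3 <= C M ^ (2 s)] for all
    large [M], which is false when [s < - 3 / 2].  The two sides of this
    comparison are [Hs_norm_tent] and [second_iterate_norm], the latter a
    consequence of [low_frequency_lower_bound].

    The rest of the proof identifies the second derivative.  The flow map is
    only known to select the solution in some uniqueness class, which contains
    the trajectories that are continuous with values in every Sobolev space; so
    such a solution has to be constructed on all of [[0, T]] for the data
    [eps h] with [eps] small.  This is a fixed point in the space of
    trajectories whose Fourier transform is bounded by a multiple of
    [exp (- |xi|) / (1 + |xi| ^ 3)]: the exponential is submultiplicative under
    convolution, and the cubic weight is recovered from the dissipation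
    ([dissipation_gain], [decaying_duhamel], [mild_exists]).  The solution
    [u_eps] satisfies
      [u_eps - u_eps' = (eps - eps') S h + (eps ^ 2 - eps' ^ 2) A h
                        + O (|eps - eps'| (|eps| + |eps'|) ^ 2)]
    by [mild_expansion].  The remainder is small enough for the expansion to be
    divided by [eps - eps']: the first derivative of the flow at [eps' h], in
    the direction [h], is [S h + 2 eps' A h + O (eps' ^ 2)], and therefore the
    second one at [0] is [2 A h] ([C2_second_order]). *)

Set Implicit Arguments.
Unset Strict Implicit.
Unset Printing Implicit Defensive.

Import Order.TTheory GRing.Theory Num.Theory.
Import numFieldNormedType.Exports.

Local Open Scope classical_set_scope.
Local Open Scope ring_scope.
Local Open Scope complex_scope.

(** * Complex-valued functions of a real variable *)

Local Notation normc := ComplexField.Normc.normc.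

Section Modulus.
Context {R : rcfType}.
Implicit Types x y z : R[i].

Lemma normc_ge0 z : 0 <= normc z.
Proof. by case: z => a b /=; exact: sqrtr_ge0. Qed.

Lemma normcD x y : normc (x + y) <= normc x + normc y.
Proof.
by have := ler_normD x y; rewrite lecE /= => /andP[_].
Qed.

Lemma normcN x : normc (- x) = normc x.
Proof. by case: x => a b /=; rewrite !sqrrN. Qed.

Lemma normcB x y : normc (x - y) <= normc x + normc y.
Proof. by rewrite -(normcN y) normcD. Qed.

Lemma normc_real (a : R) : normc a%:C = `|a|.
Proof. by rewrite /= expr0n addr0 sqrtr_sqr. Qed.

Lemma normc_conj z : normc z^* = normc z.
Proof. by case: z => a b /=; rewrite sqrrN. Qed.

Lemma Re_le_normc z : `|complex.Re z| <= normc z.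
Proof.
case: z => a b /=; rewrite -sqrtr_sqr ler_wsqrtr// lerDl sqr_ge0//.
Qed.

Lemma Im_le_normc z : `|complex.Im z| <= normc z.
Proof.
case: z => a b /=; rewrite -sqrtr_sqr ler_wsqrtr// lerDr sqr_ge0//.
Qed.

Lemma normc_le_ReIm z : normc z <= `|complex.Re z| + `|complex.Im z|.
Proof.
case: z => a b /=; have ab : 0 <= `|a| + `|b| by rewrite addr_ge0.
rewrite -[leRHS]ger0_norm// -[leRHS]sqrtr_sqr.
rewrite ler_wsqrtr// sqrrD !real_normK ?num_real//.
by rewrite -addrA lerD2l lerDr mulrn_wge0// mulr_ge0.
Qed.

Lemma ReDc x y : complex.Re (x + y) = complex.Re x + complex.Re y.
Proof. by case: x; case: y. Qed.
Lemma ImDc x y : complex.Im (x + y) = complex.Im x + complex.Im y.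
Proof. by case: x; case: y. Qed.
Lemma ReNc x : complex.Re (- x) = - complex.Re x.
Proof. by case: x. Qed.
Lemma ImNc x : complex.Im (- x) = - complex.Im x.
Proof. by case: x. Qed.
Lemma ReMc x y :
  complex.Re (x * y) = complex.Re x * complex.Re y - complex.Im x * complex.Im y.
Proof. by case: x; case: y. Qed.
Lemma ImMc x y :
  complex.Im (x * y) = complex.Re x * complex.Im y + complex.Im x * complex.Re y.
Proof. by case: x => a b; case: y => c d /=. Qed.

Lemma conjcD x y : conjc (x + y) = conjc x + conjc y.
Proof. by case: x; case: y => a b c d; simpc. Qed.

Lemma conjcN x : conjc (- x) = - conjc x.
Proof. by case: x. Qed.

Lemma conjc_rC (a : R) : conjc a%:C = a%:C.
Proof. by rewrite /= oppr0. Qed.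

Lemma conjcM x y : conjc (x * y) = conjc x * conjc y.
Proof.
by case: x; case: y => a b c d; simpc; congr (_ +i* _); ring.
Qed.

End Modulus.

Section ContinuousComplex.
Context {R : realType}.
Notation mu1 := (@lebesgue_measure R).
Implicit Types (f g : R -> R[i]) (D : set R).

Definition ccont f :=
  continuous (fun x => complex.Re (f x)) /\
  continuous (fun x => complex.Im (f x)).

Lemma ccont_real (h : R -> R) : continuous h -> ccont (fun x => (h x)%:C).
Proof. by move=> ch; split => //= x; exact: cvg_cst. Qed.

Lemma ccontD f g : ccont f -> ccont g -> ccont (fun x => f x + g x).
Proof.
move=> [fr fi] [gr gi]; split.
- under [X in continuous X]eq_fun do rewrite ReDc.
  by move=> x; apply: cvgD; [exact: fr|exact: gr].
- under [X in continuous X]eq_fun do rewrite ImDc.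
  by move=> x; apply: cvgD; [exact: fi|exact: gi].
Qed.

Lemma ccontN f : ccont f -> ccont (fun x => - f x).
Proof.
move=> [fr fi]; split.
- under [X in continuous X]eq_fun do rewrite ReNc.
  by move=> x; apply: cvgN; exact: fr.
- under [X in continuous X]eq_fun do rewrite ImNc.
  by move=> x; apply: cvgN; exact: fi.
Qed.

Lemma ccontB f g : ccont f -> ccont g -> ccont (fun x => f x - g x).
Proof. by move=> cf cg; apply: ccontD => //; exact: ccontN. Qed.

Lemma ccontM f g : ccont f -> ccont g -> ccont (fun x => f x * g x).
Proof.
move=> [fr fi] [gr gi]; split.
- under [X in continuous X]eq_fun do rewrite ReMc.
  move=> x; apply: cvgB; apply: cvgM;
    [exact: fr|exact: gr|exact: fi|exact: gi].
- under [X in continuous X]eq_fun do rewrite ImMc.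
  move=> x; apply: cvgD; apply: cvgM;
    [exact: fr|exact: gi|exact: fi|exact: gr].
Qed.

Lemma ccont_cst (c : R[i]) : ccont (fun=> c).
Proof. by split => x; exact: cvg_cst. Qed.

Lemma ccont_comp f (h : R -> R) : ccont f -> continuous h -> ccont (f \o h).
Proof.
by move=> [fr fi] ch; split=> x;
  [apply: (@continuous_comp _ _ _ h (fun y => complex.Re (f y)))
  |apply: (@continuous_comp _ _ _ h (fun y => complex.Im (f y)))];
  [exact: ch|exact: fr|exact: ch|exact: fi].
Qed.

Lemma continuous_normc f : ccont f -> continuous (fun x => normc (f x)).
Proof.
move=> [fr fi].
have -> : (fun x => normc (f x)) = (fun x =>
    Num.sqrt (complex.Re (f x) ^+ 2 + complex.Im (f x) ^+ 2)).
  by apply/funext => x; case: (f x).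
move=> x; apply: (@continuous_comp _ _ _
  (fun x => complex.Re (f x) ^+ 2 + complex.Im (f x) ^+ 2) Num.sqrt).
  by apply: cvgD; apply: cvgM; [exact: fr|exact: fr|exact: fi|exact: fi].
exact: sqrt_continuous.
Qed.

Lemma ccont_measurable f : ccont f -> cmeasurable f.
Proof. by move=> [fr fi]; split; exact: continuous_measurable_fun. Qed.

Lemma measurable_normc f : cmeasurable f ->
  measurable_fun setT (fun x => normc (f x)).
Proof.
move=> [fr fi].
have -> : (fun x => normc (f x)) = (fun x =>
    Num.sqrt (complex.Re (f x) ^+ 2 + complex.Im (f x) ^+ 2)).
  by apply/funext => x; case: (f x).
apply: (@measurableT_comp _ _ _ _ _ _ (@Num.sqrt R)).
  by apply: continuous_measurable_fun; exact: sqrt_continuous.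
by apply: measurable_funD; exact: measurable_funX.
Qed.

Lemma cmeasurableD f g : cmeasurable f -> cmeasurable g -> cmeasurable (f + g).
Proof.
move=> [fr fi] [gr gi]; split.
- under [X in measurable_fun _ X]eq_fun do rewrite ReDc.
  exact: measurable_funD.
- under [X in measurable_fun _ X]eq_fun do rewrite ImDc.
  exact: measurable_funD.
Qed.

Lemma cmeasurableN f : cmeasurable f -> cmeasurable (- f).
Proof.
move=> [fr fi]; split.
- under [X in measurable_fun _ X]eq_fun do rewrite ReNc.
  exact: measurableT_comp.
- under [X in measurable_fun _ X]eq_fun do rewrite ImNc.
  exact: measurableT_comp.
Qed.

Lemma cmeasurable_rscale (a : R) f : cmeasurable f -> cmeasurable (rscale a f).
Proof.
move=> [fr fi]; split; rewrite /rscale.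
- under [X in measurable_fun _ X]eq_fun do rewrite ReMc mul0r subr0.
  exact: measurable_funM.
- under [X in measurable_fun _ X]eq_fun do rewrite ImMc mul0r addr0.
  exact: measurable_funM.
Qed.

End ContinuousComplex.

(** * Integrals of complex-valued functions *)

Section ComplexIntegral.
Context {R : realType}.
Notation mu1 := (@lebesgue_measure R).
Implicit Types (f : R -> R[i]) (D : set R).

Lemma integrable_dominated (u g : R -> R) D : measurable D ->
  measurable_fun D u -> mu1.-integrable D (EFin \o g) ->
  (forall x, D x -> `|u x| <= g x) -> mu1.-integrable D (EFin \o u).
Proof.
move=> mD mu ig ug; apply: (@le_integrable _ _ _ mu1 D mD _ _ _ _ ig).
  exact/measurable_EFinP.
by move=> x Dx; rewrite /= lee_fin (le_trans (ug _ Dx))// ler_norm.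
Qed.

Lemma integrable_scale D (k : R) (h : R -> R) : measurable D ->
  mu1.-integrable D (EFin \o h) ->
  mu1.-integrable D (EFin \o (fun x => k * h x)).
Proof.
move=> mD ih; have := @integrableZl _ _ _ mu1 D mD k _ ih.
by apply: eq_integrable.
Qed.

Lemma cintegrable_dominated f (g : R -> R) D : measurable D ->
  cmeasurable f -> mu1.-integrable D (EFin \o g) ->
  (forall x, D x -> normc (f x) <= g x) -> cintegrable D f.
Proof.
move=> mD [fr fi] ig fg; split; apply: (integrable_dominated mD _ ig).
- exact: measurable_funTS.
- by move=> x Dx; exact: le_trans (Re_le_normc _) (fg _ Dx).
- exact: measurable_funTS.
- by move=> x Dx; exact: le_trans (Im_le_normc _) (fg _ Dx).
Qed.

(** The constant [2], instead of [1], is the price for estimating the real and the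
    imaginary part separately. *)
Lemma normc_cintegral_le f (g : R -> R) D : measurable D ->
  cmeasurable f -> mu1.-integrable D (EFin \o g) ->
  (forall x, D x -> normc (f x) <= g x) ->
  normc (cintegral D f) <= 2 * \int[mu1]_(x in D) g x.
Proof.
move=> mD mf ig fg; have [ir ii] := cintegrable_dominated mD mf ig fg.
apply: (le_trans (normc_le_ReIm _)); rewrite /= mulr2n mulrDl mul1r.
apply: lerD.
- apply: (le_trans (@le_normr_Rintegral _ _ _ mu1 D
    (fun x => complex.Re (f x)) mD ir)).
  apply: le_Rintegral => //; first exact: integrable_norm ir.
  by move=> x Dx; exact: le_trans (Re_le_normc _) (fg _ Dx).
- apply: (le_trans (@le_normr_Rintegral _ _ _ mu1 D
    (fun x => complex.Im (f x)) mD ii)).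
  apply: le_Rintegral => //; first exact: integrable_norm ii.
  by move=> x Dx; exact: le_trans (Im_le_normc _) (fg _ Dx).
Qed.

Lemma eq_cintegral D f g : (forall x, D x -> f x = g x) ->
  cintegral D f = cintegral D g.
Proof.
by move=> fg; rewrite /cintegral; congr (_ +i* _);
  apply: eq_Rintegral => x /set_mem Dx; rewrite fg.
Qed.

Lemma cintegrableD D f g : measurable D ->
  cintegrable D f -> cintegrable D g -> cintegrable D (fun x => f x + g x).
Proof.
move=> mD [fr fi] [gr gi]; split.
- have := @integrableD _ _ _ mu1 D mD _ _ fr gr.
  by apply: eq_integrable => // x _; rewrite ReDc.
- have := @integrableD _ _ _ mu1 D mD _ _ fi gi.
  by apply: eq_integrable => // x _; rewrite ImDc.
Qed.

Lemma cintegrableZ D (c : R[i]) f : measurable D ->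
  cintegrable D f -> cintegrable D (fun x => c * f x).
Proof.
move=> mD [fr fi]; case: c => a b.
have Z (k : R) (u : R -> R) := @integrable_scale D k u mD.
split.
- have := @integrableD _ _ _ mu1 D mD _ _ (Z a _ fr) (Z (- b) _ fi).
  by apply: eq_integrable => // x _; rewrite ReMc /= mulNr.
- have := @integrableD _ _ _ mu1 D mD _ _ (Z a _ fi) (Z b _ fr).
  by apply: eq_integrable => // x _; rewrite ImMc.
Qed.

Lemma cintegralD D f g : measurable D -> cintegrable D f -> cintegrable D g ->
  cintegral D (fun x => f x + g x) = cintegral D f + cintegral D g.
Proof.
move=> mD [fr fi] [gr gi]; rewrite /cintegral; simpc; congr (_ +i* _).
- by rewrite -RintegralD//; apply: eq_Rintegral => x _; rewrite ReDc.
- by rewrite -RintegralD//; apply: eq_Rintegral => x _; rewrite ImDc.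
Qed.

Lemma cintegralZ D (c : R[i]) f : measurable D -> cintegrable D f ->
  cintegral D (fun x => c * f x) = c * cintegral D f.
Proof.
move=> mD [fr fi]; case: c => a b; rewrite /cintegral; simpc.
have iZ k (h : R -> R) := @integrable_scale D k h mD.
congr (_ +i* _).
- rewrite -!RintegralZl// -RintegralB//; [|exact: iZ|exact: iZ].
  by apply: eq_Rintegral => x _; rewrite ReMc.
- rewrite -!RintegralZl// -RintegralD//; [|exact: iZ|exact: iZ].
  by apply: eq_Rintegral => x _; rewrite ImMc.
Qed.

Lemma cintegral_conj D f : measurable D -> cintegrable D f ->
  cintegral D (fun x => (f x)^*) = (cintegral D f)^*.
Proof.
move=> mD [fr fi]; rewrite /cintegral/=; congr (_ +i* _).
- by apply: eq_Rintegral => x _; case: (f x).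
- rewrite -mulN1r -RintegralZl//; apply: eq_Rintegral => x _.
  by case: (f x) => a b /=; rewrite mulN1r.
Qed.

(** Dominated convergence with a majorant that is uniform in the parameter. *)
Lemma continuous_Rintegral (F : R -> R -> R) (g : R -> R) D : measurable D ->
  (forall x, measurable_fun D (F x)) -> (forall y, D y -> continuous (F ^~ y)) ->
  mu1.-integrable D (EFin \o g) ->
  (forall x y, D y -> `|F x y| <= g y) ->
  continuous (fun x => \int[mu1]_(y in D) F x y).
Proof.
move=> mD mF cF ig Fg x.
have := @continuity_under_integral R _ _ mu1 F D mD (x - 1) (x + 1) _ _ g ig _.
apply.
- by move=> z _; apply: (integrable_dominated mD _ ig) => // y; exact: Fg.
- by apply: aeW => y Dy z _; exact: cF.
- by move=> z _; apply: aeW => y; exact: Fg.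
- by rewrite inE/= in_itv/= ltrBlDr !ltrDl ltr01.
Qed.

Lemma ccont_cintegral (F : R -> R -> R[i]) (g : R -> R) D : measurable D ->
  (forall x, cmeasurable (F x)) -> (forall y, D y -> ccont (F ^~ y)) ->
  mu1.-integrable D (EFin \o g) ->
  (forall x y, D y -> normc (F x y) <= g y) ->
  ccont (fun x => cintegral D (F x)).
Proof.
move=> mD mF cF ig Fg; split; rewrite /cintegral/=.
- apply: (continuous_Rintegral mD _ _ ig).
  + by move=> x; apply: measurable_funTS; exact: (mF x).1.
  + by move=> y Dy; exact: (cF y Dy).1.
  + by move=> x y Dy; exact: le_trans (Re_le_normc _) (Fg _ _ Dy).
- apply: (continuous_Rintegral mD _ _ ig).
  + by move=> x; apply: measurable_funTS; exact: (mF x).2.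
  + by move=> y Dy; exact: (cF y Dy).2.
  + by move=> x y Dy; exact: le_trans (Im_le_normc _) (Fg _ _ Dy).
Qed.

(** It suffices to compare the two measures on intervals. *)
Lemma lebesgue_measure_reflect (c : R) (A : set R) : measurable A ->
  pushforward mu1 (fun x : measurableTypeR R => (c - x : measurableTypeR R)) A
  = mu1 A.
Proof.
have mr : measurable_fun setT
    (fun x : measurableTypeR R => (c - x : measurableTypeR R)).
  by apply: measurable_funB.
move=> mA; apply/esym.
pose nu := pushforward mu1
  (fun x : measurableTypeR R => (c - x : measurableTypeR R)).
apply: (lebesgue_measure_unique (mu := nu)) => //= _ [[a b]] _ <-.
rewrite /nu /pushforward.
have -> : (fun x : R => c - x) @^-1` `]a, b] = `[c - b, c - a[%classic.
  by apply/seteqP; split => x /=; rewrite !in_itv/= => /andP[? ?];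
    apply/andP; split; lra.
rewrite !lebesgue_measure_itv/= !lte_fin ltrD2l ltrN2 -!EFinB.
by case: ifP => // _; congr (_%:E); ring.
Qed.


Lemma Rintegral_reflect (c : R) (f : R -> R) : measurable_fun setT f ->
  \int[mu1]_x f (c - x) = \int[mu1]_x f x.
Proof.
move=> mf; congr fine.
pose phi : measurableTypeR R -> measurableTypeR R := fun x => c - x.
have mr : measurable_fun setT phi by apply: measurable_funB.
have ge0 (h : R -> \bar R) : measurable_fun setT h ->
    (forall x, (0 <= h x)%E) ->
    (\int[mu1]_x h (c - x)%R = \int[mu1]_x h x)%E.
  move=> mh h0.
  transitivity (\int[pushforward mu1 phi]_x h x)%E; last first.
    by apply: eq_measure_integral => A mA _; exact: lebesgue_measure_reflect.
  by rewrite ge0_integral_pushforward.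
have mEf : measurable_fun setT (EFin \o f) by exact/measurable_EFinP.
rewrite [LHS]integralE [RHS]integralE; congr (_ - _)%E.
- rewrite unlock; apply: (ge0 (fun x => maxe (f x)%:E 0)) => [|x].
    by have := measurable_funepos mEf; rewrite unlock.
  by rewrite le_max lexx orbT.
- rewrite unlock; apply: (ge0 (fun x => maxe (- (f x)%:E)%E 0)) => [|x].
    by have := measurable_funeneg mEf; rewrite unlock.
  by rewrite le_max lexx orbT.
Qed.

Lemma cintegral_reflect (c : R) f : cmeasurable f ->
  cintegral setT (fun x => f (c - x)) = cintegral setT f.
Proof.
move=> [fr fi]; rewrite /cintegral; congr (_ +i* _).
- exact: (@Rintegral_reflect c (fun x => complex.Re (f x))).
- exact: (@Rintegral_reflect c (fun x => complex.Im (f x))).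
Qed.

End ComplexIntegral.

(** * The multiplier of the linear flow *)

Section Symbol.
Context {R : realType}.
Notation mu1 := (@lebesgue_measure R).
Implicit Types (mu t xi : R).

Lemma continuous_integrable_itv (f : R -> R) (a b : R) : continuous f ->
  mu1.-integrable `[a, b] (EFin \o f).
Proof.
move=> cf; apply: continuous_compact_integrable; first exact: segment_compact.
exact: continuous_subspaceT.
Qed.

Lemma Rintegral_cst_itv (c a b : R) : a <= b ->
  \int[mu1]_(x in `[a, b]) c = c * (b - a).
Proof.
move=> ab; rewrite Rintegral_cst//; congr (_ * _).
suff h : mu1 `[a, b]%classic = (b - a)%:E by exact: (congr1 fine h).
rewrite lebesgue_measure_itv/= lte_fin; case: ifP => // /negbT.
rewrite -leNgt => ba.
have -> : a = b by apply/eqP; rewrite eq_le ab ba.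
by rewrite subrr.
Qed.

Lemma integral_exp (c d t : R) : 0 <= t ->
  \int[mu1]_(tau in `[0, t]) (c * expR (c * tau + d)) =
  expR (c * t + d) - expR d.
Proof.
rewrite le_eqVlt => /predU1P[<-|t0].
  by rewrite set_itv1 Rintegral_set1 mulr0 add0r subrr.
have dF (x : R) : is_derive x (1 : R) (fun tau => expR (c * tau + d))
    (c * expR (c * x + d)).
  have h : is_derive x (1 : R) (fun tau : R => c * tau + d) c.
    by apply: is_derive_eq; rewrite addr0 /GRing.scale/= mulr1.
  have := @is_derive1_comp _ expR (fun tau : R => c * tau + d) x _ _ _ h.
  by move=> /(_ _ (is_derive_expR _)); rewrite mulrC.
have cF : continuous (fun tau => expR (c * tau + d)).
  move=> x; apply: differentiable_continuous; apply/derivable1_diffP.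
  by case: (dF x).
rewrite /Rintegral (@continuous_FTC2 _ _ (fun tau => expR (c * tau + d)))//=.
- by rewrite mulr0 add0r.
- apply: continuous_subspaceT => x; apply: cvgM; first exact: cvg_cst.
  exact: cF.
- split.
  + by move=> x _; case: (dF x).
  + by apply: cvg_at_right_filter; exact: cF.
  + by apply: cvg_at_left_filter; exact: cF.
- by move=> x _; rewrite derive1E; case: (dF x).
Qed.

Lemma normc_symbol mu t xi :
  normc (npBO_symbol mu t xi) = expR (mu * (`|xi| - `|xi| ^+ 3) * t).
Proof.
rewrite ComplexField.Normc.normcM normc_real /= cos2Dsin2 sqrtr1 mulr1.
by rewrite ger0_norm// expR_ge0.
Qed.

Lemma symbolD mu t t' xi :
  npBO_symbol mu (t + t') xi = npBO_symbol mu t xi * npBO_symbol mu t' xi.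
Proof.
rewrite /npBO_symbol !mulrDr expRD cosD sinD; simpc; congr (_ +i* _); ring.
Qed.

Lemma symbol_conj mu t xi : npBO_symbol mu t (- xi) = (npBO_symbol mu t xi)^*.
Proof.
rewrite /npBO_symbol normrN !mulNr cosN sinN; simpc.
by congr (_ +i* _); rewrite mulrN.
Qed.

Lemma ccont_cis (h : R -> R) : continuous h ->
  ccont (fun x => cos (h x) +i* sin (h x)).
Proof.
move=> ch; split=> x /=.
- by apply: (@continuous_comp _ _ _ h cos); [exact: ch|exact: continuous_cos].
- by apply: (@continuous_comp _ _ _ h sin); [exact: ch|exact: continuous_sin].
Qed.

Lemma continuous_expR_comp (h : R -> R) : continuous h ->
  continuous (fun x => expR (h x)).
Proof.
move=> ch x; apply: (@continuous_comp _ _ _ h expR); first exact: ch.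
exact: continuous_expR.
Qed.

Lemma ccont_symbol_xi mu t : ccont (npBO_symbol mu t).
Proof.
have cabs : continuous (fun x : R => `|x|) by exact: norm_continuous.
have cX3 : continuous (fun x : R => `|x| ^+ 3).
  by move=> x; apply: (@continuous_comp _ _ _ (fun y : R => `|y|)
    (fun y => y ^+ 3)); [exact: cabs|exact: exprn_continuous].
apply: ccontM; [apply/ccont_real/continuous_expR_comp|apply: ccont_cis] => x.
- apply: cvgM; last exact: cvg_cst; apply: cvgM; first exact: cvg_cst.
  by apply: cvgB; [exact: cabs|exact: cX3].
- by apply: cvgM; last exact: cvg_cst; apply: cvgM; [exact: cvg_id|exact: cabs].
Qed.

Lemma ccont_symbol_t mu xi : ccont (fun t => npBO_symbol mu t xi).
Proof.
apply: ccontM; [apply/ccont_real/continuous_expR_comp|apply: ccont_cis] => x;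
  by apply: cvgM; [exact: cvg_cst|exact: cvg_id].
Qed.

(** The growth rate [mu (r - r ^ 3)] is at most [mu]. *)
Lemma symbol_le mu t xi : 0 <= mu -> 0 <= t ->
  normc (npBO_symbol mu t xi) <= expR (mu * t).
Proof.
move=> mu0 t0; rewrite normc_symbol ler_expR ler_wpM2r//.
rewrite -[leRHS]mulr1 ler_wpM2l//; have := normr_ge0 xi.
set r := `|xi| => r0; have [r1|/ltW r1] := leP r 1.
  by rewrite (le_trans _ r1)// gerBl exprn_ge0.
by rewrite (@le_trans _ _ 0)// subr_le0 -{1}(expr1 r) ler_weXn2l.
Qed.

(** The two terms are the contributions of the frequencies [|xi| <= 2] and
    [|xi| >= 2]; see [dissipation_gain]. *)
Definition gain_cst (mu T : R) := 9 * T * expR (mu * T) + 2 / mu.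

(** The dissipation gains three derivatives in time average; at low
    frequencies, where it is absent, the length of the time interval bounds
    the integral instead. *)
Lemma dissipation_gain mu T t xi : 0 < mu -> 0 <= t <= T ->
  (1 + `|xi| ^+ 3) *
    \int[mu1]_(tau in `[0, t]) normc (npBO_symbol mu (t - tau) xi)
  <= gain_cst mu T.
Proof.
move=> mu0 /andP[t0 tT]; have T0 := le_trans t0 tT.
have r0 := normr_ge0 xi.
have rM0 : 0 <= 1 + `|xi| ^+ 3 by rewrite addr_ge0// exprn_ge0.
have cint : mu1.-integrable `[0, t]
    (EFin \o (fun tau => normc (npBO_symbol mu (t - tau) xi))).
  apply: continuous_integrable_itv; apply: continuous_normc.
  apply: (@ccont_comp _ (fun tau => npBO_symbol mu tau xi) (fun tau => t - tau)).
    exact: ccont_symbol_t.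
  by move=> x; apply: cvgB; [exact: cvg_cst|exact: cvg_id].
have [r2|/ltW r2] := leP `|xi| 2.
- apply: (@le_trans _ _ (9 * (T * expR (mu * T)))); last first.
    by rewrite /gain_cst mulrA lerDl divr_ge0// ltW.
  apply: ler_pM => //.
  + by apply: Rintegral_ge0 => x _; exact: normc_ge0.
  + by have := lerXn2r 3 r0 (ler0n _ 2) r2; lra.
  + have ic : mu1.-integrable `[0, t] (EFin \o cst (expR (mu * T))).
      by apply: continuous_integrable_itv => x; exact: cvg_cst.
    apply: (@le_trans _ _ (\int[mu1]_(tau in `[0, t]) expR (mu * T))).
      apply: le_Rintegral => // x; rewrite /= in_itv/= => /andP[x0 xt].
      apply: (le_trans (symbol_le _ _ _)); rewrite ?subr_ge0//; first exact: ltW.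
      by rewrite ler_expR ler_wpM2l ?(ltW mu0)//; lra.
    by rewrite Rintegral_cst_itv// subr0 mulrC ler_wpM2r ?expR_ge0.
- pose a := mu * (`|xi| ^+ 3 - `|xi|).
  have r3 : 1 + `|xi| ^+ 3 <= 2 * (`|xi| ^+ 3 - `|xi|) by nra.
  have a0 : 0 < a by apply: mulr_gt0 => //; nra.
  have -> : \int[mu1]_(tau in `[0, t]) normc (npBO_symbol mu (t - tau) xi) =
      a^-1 * (1 - expR (- a * t)).
    have <- : expR (a * t + - a * t) = 1 by rewrite mulNr subrr expR0.
    rewrite -integral_exp//.
    rewrite -RintegralZl//; last first.
      apply: (continuous_integrable_itv (f := fun tau =>
        a * expR (a * tau + - a * t))) => x.
      apply: cvgM; first exact: cvg_cst.
      apply: (continuous_expR_comp (h := fun tau => a * tau + - a * t)) => y.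
      apply: cvgD; last exact: cvg_cst.
      by apply: cvgM; [exact: cvg_cst|exact: cvg_id].
    apply: eq_Rintegral => x _; rewrite mulKf ?gt_eqF//.
    by rewrite normc_symbol; congr expR; rewrite /a; ring.
  apply: (@le_trans _ _ (2 / mu)); last first.
    by rewrite /gain_cst lerDr !mulr_ge0// expR_ge0.
  have e1 : 1 - expR (- a * t) <= 1 by rewrite gerBl expR_ge0.
  rewrite mulrA; apply: (le_trans (ler_wpM2l _ e1)).
    by rewrite divr_ge0// ltW.
  rewrite mulr1 ler_pdivrMr// /a mulrA divfK ?gt_eqF//.
Qed.

End Symbol.

(** * Exponential weights and a clamped time *)

Section Decay.
Context {R : realType}.
Notation mu1 := (@lebesgue_measure R).
Implicit Types (xi eta : R).

(** The weight of the trajectories.  The exponential makes them smooth, and the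
    cubic factor is the one that [dissipation_gain] recovers. *)
Definition decay xi := expR (- `|xi|) / (1 + `|xi| ^+ 3).

Definition lorentz eta : R := 2 / (1 + eta ^+ 2).

Lemma decay_ge0 xi : 0 <= decay xi.
Proof. by rewrite divr_ge0 ?expR_ge0// addr_ge0// exprn_ge0. Qed.

Lemma expRN_norm_le1 xi : expR (- `|xi|) <= 1.
Proof. by rewrite -[leRHS]expR0 ler_expR oppr_le0. Qed.

Lemma decay0 : decay 0 = 1.
Proof. by rewrite /decay normr0 oppr0 expR0 expr0n addr0 divr1. Qed.

Lemma decay_le1 xi : decay xi <= 1.
Proof.
rewrite /decay ler_pdivrMr ?ltr_wpDr ?exprn_ge0// mul1r.
by apply: le_trans (expRN_norm_le1 _) _; rewrite lerDl exprn_ge0.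
Qed.

Lemma lorentz_ge0 eta : 0 <= lorentz eta.
Proof. by rewrite divr_ge0// addr_ge0// sqr_ge0. Qed.

Lemma integrable_lorentz : mu1.-integrable setT (EFin \o lorentz).
Proof.
apply: (@integrable_scale _ _ 2 (fun x : R => (oneDsqr x)^-1)) => //.
apply/integrableP; split.
  by apply/measurable_EFinP; apply: continuous_measurable_fun;
    exact: continuous_oneDsqrV.
under eq_integral => x _ do rewrite /= ger0_norm ?invr_ge0//.
rewrite (@ge0_symfun_integralT _ (fun x : R => (oneDsqr x)^-1)).
- by rewrite -set_itvcy integral0y_oneDsqr ltry.
- by move=> x; rewrite /= invr_ge0.
- exact: continuous_oneDsqrV.
- by move=> x; rewrite /= /oneDsqr sqrrN.
Qed.

Lemma decay_le_lorentz eta : decay eta <= lorentz eta.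
Proof.
rewrite /decay /lorentz ler_pdivrMr ?ltr_wpDr ?exprn_ge0// mulrAC.
rewrite ler_pdivlMr ?ltr_wpDr ?sqr_ge0//.
have e1 := expRN_norm_le1 eta.
rewrite -(real_normK (num_real eta)); have := normr_ge0 eta.
move: `|eta| e1 => r e1 r0.
apply: (@le_trans _ _ (1 * (1 + r ^+ 2))).
  by rewrite ler_wpM2r// addr_ge0// sqr_ge0.
rewrite mul1r mulrDr mulr1; have r3 := exprn_ge0 3 r0.
have [r1|/ltW r1] := leP r 1.
  have : r ^+ 2 <= 1 by rewrite expr_le1.
  lra.
have : r ^+ 2 <= r ^+ 3 by rewrite ler_weXn2l.
lra.
Qed.

(** The first cubic weight is dropped and the second one pays for both the
    derivative and the integrability in [eta], while
    [exp (- |xi - eta|) exp (- |eta|) <= exp (- |xi|)]. *)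
Lemma decay_convolution xi eta :
  decay (xi - eta) * (`|eta| * decay eta) <= expR (- `|xi|) * lorentz eta.
Proof.
rewrite /decay /lorentz.
have p0 (y : R) : 0 <= `|y| ^+ 3 by rewrite exprn_ge0.
have -> : expR (- `|xi - eta|) / (1 + `|xi - eta| ^+ 3) *
    (`|eta| * (expR (- `|eta|) / (1 + `|eta| ^+ 3))) =
    (expR (- `|xi - eta|) * expR (- `|eta|)) *
    ((1 + `|xi - eta| ^+ 3)^-1 * (`|eta| / (1 + `|eta| ^+ 3))).
  by ring.
apply: ler_pM.
- by rewrite mulr_ge0 ?expR_ge0.
- by rewrite mulr_ge0 ?divr_ge0 ?invr_ge0 ?addr_ge0.
- rewrite -expRD ler_expR -opprD lerN2.
  by rewrite -{1}(subrK eta xi) ler_normD.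
- rewrite -[leRHS]mul1r; apply: ler_pM.
  + by rewrite invr_ge0 addr_ge0.
  + by rewrite divr_ge0 ?addr_ge0.
  + by rewrite invf_le1 ?lerDl// ltr_wpDr.
  + rewrite ler_pdivrMr ?ltr_wpDr// mulrAC ler_pdivlMr ?ltr_wpDr ?sqr_ge0//.
    rewrite -(real_normK (num_real eta)); have := normr_ge0 eta.
    move: `|eta| => r r0; have [r1|/ltW r1] := leP r 1.
      by have := exprn_ge0 3 r0; rewrite exprS; nra.
    have : r <= r ^+ 3 by rewrite -{1}(expr1 r) ler_weXn2l.
    by rewrite mulrDr mulr1 -exprS; lra.
Qed.

End Decay.

Section Clamp.
Context {R : realType}.
Notation mu1 := (@lebesgue_measure R).
Implicit Types (T t : R).

(** Freezing a trajectory outside [[0, T]] lets all continuity statements be made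
    on the whole line. *)
Definition clamp T t := Num.max 0 (Num.min t T).

Lemma clamp_itv T t : 0 <= T -> 0 <= clamp T t <= T.
Proof.
by move=> T0; rewrite /clamp le_max lexx/= ge_max T0 ge_min lexx orbT.
Qed.

Lemma clamp_id T t : 0 <= t <= T -> clamp T t = t.
Proof.
by move=> /andP[t0 tT]; rewrite /clamp min_l// max_r.
Qed.

Lemma continuous_clamp T : continuous (clamp T).
Proof.
have -> : clamp T = fun t => Num.max 0 ((t + T - `|t - T|) / 2).
  apply/funext => t; rewrite /clamp; congr Num.max.
  by case: (leP t T) => tT; [rewrite ler0_norm|rewrite gtr0_norm]; lra.
have -> : (fun t : R => Num.max 0 ((t + T - `|t - T|) / 2)) =
   (fun t : R => (((t + T - `|t - T|) / 2) + `|(t + T - `|t - T|) / 2|) / 2).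
  apply/funext => t; move: ((t + T - `|t - T|) / 2) => u.
  by case: (leP 0 u) => u0; [rewrite ger0_norm|rewrite ltr0_norm]; lra.
have c1 : continuous (fun t : R => (t + T - `|t - T|) / 2).
  move=> t; apply: cvgM; last exact: cvg_cst.
  apply: cvgB; first by apply: cvgD; [exact: cvg_id|exact: cvg_cst].
  by apply: cvg_norm; apply: cvgB; [exact: cvg_id|exact: cvg_cst].
move=> t; apply: cvgM; last exact: cvg_cst.
by apply: cvgD; [exact: c1|apply: cvg_norm; exact: c1].
Qed.

Lemma continuous_primitive_clamp T (q : R -> R) : 0 <= T -> continuous q ->
  continuous (fun t => \int[mu1]_(tau in `[0, clamp T t]) q tau).
Proof.
move=> T0 cq.
have := @parameterized_integral_continuous _ 0 T q T0
  (@continuous_integrable_itv _ _ _ _ cq).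
move=> /subspace_continuousP cp t S.
have cA : `[0, T]%classic (clamp T t) by rewrite /= in_itv/= clamp_itv.
move=> /(cp _ cA) nS; have := @continuous_clamp T t _ nS.
rewrite !nbhs_simpl => H; apply: (@filterS _ (nbhs t) _ _ _ _ H) => x /=.
by apply; rewrite in_itv/= clamp_itv.
Qed.

End Clamp.

(** * Exponentially decaying trajectories and their products *)

Section Fields.
Context {R : realType}.
Notation mu1 := (@lebesgue_measure R).
Implicit Types (U V : R -> R -> R[i]) (A M t xi : R).

(** The ball of radius [A] of a Banach space of trajectories.  Continuity is
    only asked for separately in [t] and in [xi]: with the uniform bound, this
    is enough for dominated convergence, and it is preserved by uniform limits.
    The Hermitian symmetry is there for the real-valued distributions. *)
Definition decaying A U :=
  [/\ forall t xi, normc (U t xi) <= A * decay xi,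
      forall t, ccont (U t),
      forall xi, ccont (U ^~ xi) &
      forall t xi, U t (- xi) = conjc (U t xi)].

Lemma decaying_le A M U : A <= M -> decaying A U -> decaying M U.
Proof.
move=> AM [bU cx ct hU]; split=> // t xi.
by rewrite (le_trans (bU t xi))// ler_wpM2r// decay_ge0.
Qed.

Lemma decaying_ge0 A U : decaying A U -> 0 <= A.
Proof.
move=> [bU _ _ _]; have := le_trans (normc_ge0 _) (bU 0 0).
by rewrite decay0 mulr1.
Qed.

Lemma decayingD A M U V : decaying A U -> decaying M V ->
  decaying (A + M) (fun t xi => U t xi + V t xi).
Proof.
move=> [bU cx ct hU] [bV dx dt hV]; split.
- move=> t xi; rewrite mulrDl (le_trans (normcD _ _))//.
  by rewrite lerD// ?bU ?bV.
- by move=> t; exact: ccontD.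
- by move=> xi; exact: ccontD.
- by move=> t xi; rewrite hU hV conjcD.
Qed.

Lemma decayingN A U : decaying A U -> decaying A (fun t xi => - U t xi).
Proof.
move=> [bU cx ct hU]; split.
- by move=> t xi; rewrite normcN bU.
- by move=> t; exact: ccontN.
- by move=> xi; exact: ccontN.
- by move=> t xi; rewrite hU conjcN.
Qed.

Lemma decayingB A M U V : decaying A U -> decaying M V ->
  decaying (A + M) (fun t xi => U t xi - V t xi).
Proof. by move=> fU fV; apply: decayingD => //; exact: decayingN. Qed.

Lemma decayingZ A (a : R) U : decaying A U ->
  decaying (`|a| * A) (fun t xi => a%:C * U t xi).
Proof.
move=> [bU cx ct hU]; split.
- move=> t xi; rewrite ComplexField.Normc.normcM normc_real -mulrA.
  by rewrite ler_wpM2l.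
- by move=> t; apply: ccontM => //; exact: ccont_cst.
- by move=> xi; apply: ccontM => //; exact: ccont_cst.
- by move=> t xi; rewrite hU conjcM; rewrite conjc_rC.
Qed.

Lemma ccont_reflect (f : R -> R[i]) (c : R) :
  ccont f -> ccont (fun x => f (c - x)).
Proof.
move=> cf; apply: (@ccont_comp _ f (fun x => c - x)) => // x.
by apply: cvgB; [exact: cvg_cst|exact: cvg_id].
Qed.

Lemma ccont_shift (f : R -> R[i]) (c : R) :
  ccont f -> ccont (fun x => f (x - c)).
Proof.
move=> cf; apply: (@ccont_comp _ f (fun x => x - c)) => // x.
by apply: cvgB; [exact: cvg_id|exact: cvg_cst].
Qed.

Lemma ccont_dx (f : R -> R[i]) : ccont f -> ccont (dx f).
Proof.
move=> cf; apply: ccontM => //; split => /= x; first exact: cvg_cst.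
exact: cvg_id.
Qed.

Lemma normc_dx (f : R -> R[i]) xi : normc (dx f xi) = `|xi| * normc (f xi).
Proof.
rewrite /dx ComplexField.Normc.normcM; congr (_ * _).
by rewrite /= expr0n add0r sqrtr_sqr.
Qed.

Section Product.
Variables (A M : R) (U V : R -> R -> R[i]).
Hypotheses (fU : decaying A U) (fV : decaying M V).

Let integrand t xi eta := U t (xi - eta) * dx (V t) eta.

Lemma normc_product_integrand t xi eta :
  normc (integrand t xi eta) <= A * M * expR (- `|xi|) * lorentz eta.
Proof.
have [bU _ _ _] := fU; have [bV _ _ _] := fV.
have A0 := decaying_ge0 fU; have M0 := decaying_ge0 fV.
rewrite /integrand ComplexField.Normc.normcM normc_dx.
apply: (@le_trans _ _ ((A * decay (xi - eta)) * (`|eta| * (M * decay eta)))).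
  apply: ler_pM; rewrite ?normc_ge0 ?mulr_ge0 ?normc_ge0//.
  by rewrite ler_wpM2l.
have -> : A * decay (xi - eta) * (`|eta| * (M * decay eta)) =
  A * M * (decay (xi - eta) * (`|eta| * decay eta)) by ring.
by rewrite -!mulrA !ler_wpM2l// mulrA; exact: decay_convolution.
Qed.

Lemma integrable_product_majorant (c : R) :
  mu1.-integrable setT (EFin \o (fun eta => c * lorentz eta)).
Proof. exact: integrable_scale (integrable_lorentz (R:=R)). Qed.

Lemma cmeasurable_product_integrand t xi : cmeasurable (integrand t xi).
Proof.
have [_ cU _ _] := fU; have [_ cV _ _] := fV.
apply: ccont_measurable; apply: ccontM; last exact: ccont_dx.
exact: ccont_reflect.
Qed.

Lemma decaying_product_defined t xi : product_hat_defined (U t) (dx (V t)) xi.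
Proof.
apply: (cintegrable_dominated measurableT (cmeasurable_product_integrand t xi)
  (integrable_product_majorant (A * M * expR (- `|xi|)))).
by move=> eta _; exact: normc_product_integrand.
Qed.

Definition product_cst : R := `|(2 * pi)^-1| * (2 * \int[mu1]_x lorentz x).

Lemma product_cst_ge0 : 0 <= product_cst.
Proof.
apply: mulr_ge0 => //; apply: mulr_ge0 => //.
by apply: Rintegral_ge0 => x _; exact: lorentz_ge0.
Qed.

Lemma normc_product t xi :
  normc (product_hat (U t) (dx (V t)) xi) <=
  product_cst * (A * M) * expR (- `|xi|).
Proof.
rewrite /product_hat ComplexField.Normc.normcM normc_real /product_cst.
rewrite -!mulrA ler_wpM2l//.
have := normc_cintegral_le measurableT (cmeasurable_product_integrand t xi)
  (integrable_product_majorant (A * M * expR (- `|xi|)))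
  (fun eta _ => normc_product_integrand t xi eta).
move=> /le_trans; apply; rewrite RintegralZl//; last exact: integrable_lorentz.
by rewrite le_eqVlt; apply/orP; left; apply/eqP; ring.
Qed.

Lemma ccont_product_xi t : ccont (product_hat (U t) (dx (V t))).
Proof.
have [_ cU _ _] := fU; have A0 := decaying_ge0 fU; have M0 := decaying_ge0 fV.
apply: ccontM; first exact: ccont_cst.
apply: (ccont_cintegral measurableT (F := integrand t) _ _
  (integrable_product_majorant (A * M))).
- exact: cmeasurable_product_integrand.
- move=> eta _; apply: ccontM; last exact: ccont_cst.
  exact: ccont_shift.
- move=> xi eta _; apply: (le_trans (normc_product_integrand _ _ _)).
  rewrite ler_wpM2r ?lorentz_ge0// ler_piMr ?mulr_ge0//.
Qed.

Lemma ccont_product_t xi : ccont (fun t => product_hat (U t) (dx (V t)) xi).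
Proof.
have [_ _ cU _] := fU; have [_ _ cV _] := fV.
apply: ccontM; first exact: ccont_cst.
apply: (ccont_cintegral measurableT (F := fun t => integrand t xi) _ _
  (integrable_product_majorant (A * M * expR (- `|xi|)))).
- by move=> t; exact: cmeasurable_product_integrand.
- move=> eta _; apply: ccontM => //; apply: ccontM => //; exact: ccont_cst.
- by move=> t eta _; exact: normc_product_integrand.
Qed.

(** The substitution [eta |-> - eta] in the convolution. *)
Lemma product_conj t xi :
  product_hat (U t) (dx (V t)) (- xi) = conjc (product_hat (U t) (dx (V t)) xi).
Proof.
have [_ cU _ hU] := fU; have [_ cV _ hV] := fV.
rewrite /product_hat conjcM; rewrite conjc_rC; congr (_ * _).
rewrite -(cintegral_reflect 0 (cmeasurable_product_integrand t (- xi))).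
rewrite -cintegral_conj//; last exact: decaying_product_defined.
apply: eq_cintegral => eta _; rewrite /integrand conjcM -hU.
have -> : - xi - (0 - eta) = - (xi - eta) by ring.
congr (_ * _); rewrite sub0r /dx hV conjcM; congr (_ * _).
Qed.

End Product.
End Fields.

(** * The Duhamel operator *)

Section Duhamel.
Context {R : realType}.
Notation mu1 := (@lebesgue_measure R).
Variables (mu T : R).
Hypotheses (mu0 : 0 < mu) (T0 : 0 <= T).
Implicit Types (U V : R -> R -> R[i]) (A M t xi : R).

Let c := clamp T.

Let cT t : 0 <= c t <= T. Proof. exact: clamp_itv. Qed.

(** The bilinear part of the integral equation, with the time clamped to
    [[0, T]] so that it acts on trajectories defined on the whole line. *)
Definition duhamel U V t xi : R[i] :=
  - cintegral `[0, clamp T t] (fun tau =>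
      npBO_symbol mu (clamp T t - tau) xi * product_hat (U tau) (dx (V tau)) xi).

Lemma duhamelE U V t xi : 0 <= t <= T ->
  duhamel U V t xi = - cintegral `[0, t] (fun tau =>
    npBO_symbol mu (t - tau) xi * product_hat (U tau) (dx (V tau)) xi).
Proof. by move=> tT; rewrite /duhamel clamp_id. Qed.

Lemma ccont_integrable_itv (f : R -> R[i]) (a b : R) : ccont f ->
  cintegrable `[a, b] f.
Proof. by move=> [fr fi]; split; exact: continuous_integrable_itv. Qed.

Section Bound.
Variables (A M : R) (U V : R -> R -> R[i]).
Hypotheses (fU : decaying A U) (fV : decaying M V).

Let P tau xi := product_hat (U tau) (dx (V tau)) xi.

Lemma ccont_duhamel_integrand t xi :
  ccont (fun tau => npBO_symbol mu (t - tau) xi * P tau xi).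
Proof.
apply: ccontM; last exact: (ccont_product_t fU fV).
exact: (ccont_reflect (f := fun t => npBO_symbol mu t xi) _
  (ccont_symbol_t mu xi)).
Qed.

Definition duhamel_cst : R := 2 * @product_cst R * gain_cst mu T.

Lemma duhamel_cst_ge0 : 0 <= duhamel_cst.
Proof.
apply: mulr_ge0; first by rewrite mulr_ge0// product_cst_ge0.
by rewrite /gain_cst addr_ge0 ?divr_ge0 ?mulr_ge0 ?expR_ge0// ltW.
Qed.

(** [normc_product] loses the cubic weight of [decay], and the time integral of
    the multiplier gives it back. *)
Lemma normc_duhamel t xi :
  normc (duhamel U V t xi) <= duhamel_cst * (A * M) * decay xi.
Proof.
have A0 := decaying_ge0 fU; have M0 := decaying_ge0 fV.
rewrite /duhamel normcN -/(c t); have ct := cT t.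
set k := @product_cst R * (A * M) * expR (- `|xi|).
have cm : continuous (fun tau => normc (npBO_symbol mu (c t - tau) xi)).
  apply: continuous_normc.
  exact: (ccont_reflect (f := fun t => npBO_symbol mu t xi) _
    (ccont_symbol_t mu xi)).
have im := @continuous_integrable_itv _ _ 0 (c t) cm.
have fg tau : `[0, c t]%classic tau ->
    normc (npBO_symbol mu (c t - tau) xi * P tau xi) <=
    k * normc (npBO_symbol mu (c t - tau) xi).
  move=> _; rewrite ComplexField.Normc.normcM mulrC ler_wpM2r ?normc_ge0//.
  exact: normc_product.
apply: (le_trans (normc_cintegral_le (measurable_itv _)
  (ccont_measurable (ccont_duhamel_integrand (c t) xi))
  (integrable_scale k (measurable_itv _) im) fg)).
rewrite RintegralZl//.
have := dissipation_gain xi mu0 ct.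
set I := (X in _ * X <= _) => h.
have p0 : 0 < 1 + `|xi| ^+ 3 by rewrite ltr_wpDr// exprn_ge0.
have k0 := @product_cst_ge0 R.
have hI : I <= gain_cst mu T / (1 + `|xi| ^+ 3).
  by rewrite ler_pdivlMr// mulrC.
have k2 : 0 <= 2 * k by rewrite /k; apply: mulr_ge0 => //; apply: mulr_ge0;
  [apply: mulr_ge0 => //; exact: mulr_ge0|exact: expR_ge0].
apply: (@le_trans _ _ (2 * k * I)); first by rewrite mulrA.
apply: (le_trans (ler_wpM2l k2 hI)).
by rewrite le_eqVlt /k /duhamel_cst /decay; apply/orP; left; apply/eqP; ring.
Qed.

Lemma ccont_duhamel_xi t : ccont (duhamel U V t).
Proof.
have A0 := decaying_ge0 fU; have M0 := decaying_ge0 fV.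
apply: ccontN; rewrite -/(c t); have /andP[c0 cle] := cT t.
pose k := expR (mu * T) * (@product_cst R * (A * M)).
have k0 := @product_cst_ge0 R.
have cst_cont : continuous (fun _ : R => k) by move=> x; exact: cvg_cst.
apply: (ccont_cintegral (measurable_itv _)
  (F := fun xi tau => npBO_symbol mu (c t - tau) xi * P tau xi) _ _
  (@continuous_integrable_itv _ _ 0 (c t) cst_cont)).
- by move=> xi; apply: ccont_measurable; exact: ccont_duhamel_integrand.
- move=> tau _; apply: ccontM; first exact: ccont_symbol_xi.
  exact: (ccont_product_xi fU fV).
- move=> xi tau itau.
  have /andP[tau0 tauc] : 0 <= tau <= c t by move: itau; rewrite /= in_itv.
  rewrite -[X in normc X]/(npBO_symbol mu (c t - tau) xi * P tau xi).
  rewrite ComplexField.Normc.normcM; apply: ler_pM; rewrite ?normc_ge0//.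
    apply: (le_trans (symbol_le _ _ _)); rewrite ?subr_ge0//; first exact: ltW.
    by rewrite ler_expR ler_wpM2l ?(ltW mu0)//; lra.
  apply: (le_trans (normc_product fU fV _ _)).
  apply: ler_piMr; first by apply: mulr_ge0 => //; exact: mulr_ge0.
  by rewrite -expR0 ler_expR oppr_le0.
Qed.

(** Factoring the multiplier as [m (t - tau) = m t * m (- tau)] leaves [t] only in
    the upper bound of the integral. *)
Lemma ccont_duhamel_t xi : ccont (fun t => duhamel U V t xi).
Proof.
have -> : (fun t => duhamel U V t xi) = (fun t =>
    - (npBO_symbol mu (clamp T t) xi * cintegral `[0, clamp T t] (fun tau =>
      npBO_symbol mu (- tau) xi * P tau xi))).
  apply/funext => t; rewrite /duhamel -cintegralZ//; last first.
    apply: ccont_integrable_itv.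
    have := ccont_duhamel_integrand 0 xi; rewrite /P.
    by under [X in ccont X]eq_fun do rewrite sub0r.
  by congr (- _); apply: eq_cintegral => tau _; rewrite symbolD mulrA.
apply: ccontN; apply: ccontM.
  apply: (@ccont_comp _ (fun t => npBO_symbol mu t xi) (clamp T)).
    exact: ccont_symbol_t.
  exact: continuous_clamp.
have [cr ci] : ccont (fun tau => npBO_symbol mu (- tau) xi * P tau xi).
  have := ccont_duhamel_integrand 0 xi; rewrite /P.
  by under [X in ccont X]eq_fun do rewrite sub0r.
by split; exact: continuous_primitive_clamp.
Qed.

Lemma decaying_duhamel : decaying (duhamel_cst * (A * M)) (duhamel U V).
Proof.
split.
- exact: normc_duhamel.
- exact: ccont_duhamel_xi.
- exact: ccont_duhamel_t.
- move=> t xi; rewrite /duhamel conjcN -cintegral_conj//; last first.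
    exact: ccont_integrable_itv (ccont_duhamel_integrand _ _).
  congr (- _); apply: eq_cintegral => tau _.
  by rewrite conjcM symbol_conj (product_conj fU fV).
Qed.

End Bound.

Section Bilinear.
Variables (A A' M : R) (U U' V : R -> R -> R[i]).
Hypotheses (fU : decaying A U) (fU' : decaying A' U') (fV : decaying M V).

Lemma product_hatDl t xi :
  product_hat (fun x => U t x + U' t x) (dx (V t)) xi =
  product_hat (U t) (dx (V t)) xi + product_hat (U' t) (dx (V t)) xi.
Proof.
rewrite /product_hat -mulrDr -cintegralD//; first last.
- exact: (decaying_product_defined fU' fV).
- exact: (decaying_product_defined fU fV).
by congr (_ * _); apply: eq_cintegral => eta _; rewrite mulrDl.
Qed.

Lemma product_hatDr t xi :
  product_hat (V t) (dx (fun x => U t x + U' t x)) xi =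
  product_hat (V t) (dx (U t)) xi + product_hat (V t) (dx (U' t)) xi.
Proof.
rewrite /product_hat -mulrDr -cintegralD//; first last.
- exact: (decaying_product_defined fV fU').
- exact: (decaying_product_defined fV fU).
by congr (_ * _); apply: eq_cintegral => eta _; rewrite /dx !mulrDr.
Qed.

Lemma product_hatZl t xi (a : R) :
  product_hat (fun x => a%:C * U t x) (dx (V t)) xi =
  a%:C * product_hat (U t) (dx (V t)) xi.
Proof.
rewrite /product_hat mulrCA -(cintegralZ a%:C)//; last first.
  exact: (decaying_product_defined fU fV).
by congr (_ * _); apply: eq_cintegral => eta _; rewrite mulrA.
Qed.

Lemma product_hatZr t xi (a : R) :
  product_hat (V t) (dx (fun x => a%:C * U t x)) xi =
  a%:C * product_hat (V t) (dx (U t)) xi.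
Proof.
rewrite /product_hat mulrCA -(cintegralZ a%:C)//; last first.
  exact: (decaying_product_defined fV fU).
by congr (_ * _); apply: eq_cintegral => eta _; rewrite /dx; ring.
Qed.

Let integrable_duhamel B N W Z t xi : decaying B W -> decaying N Z ->
  cintegrable `[0, clamp T t] (fun tau =>
    npBO_symbol mu (clamp T t - tau) xi * product_hat (W tau) (dx (Z tau)) xi).
Proof.
by move=> fW fZ; exact: ccont_integrable_itv (ccont_duhamel_integrand fW fZ _ _).
Qed.

Lemma duhamelDl t xi :
  duhamel (fun s x => U s x + U' s x) V t xi =
  duhamel U V t xi + duhamel U' V t xi.
Proof.
rewrite /duhamel -opprD; congr (- _).
rewrite -cintegralD//; first last.
- exact: integrable_duhamel fU' fV.
- exact: integrable_duhamel fU fV.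
by apply: eq_cintegral => tau _; rewrite product_hatDl mulrDr.
Qed.

Lemma duhamelDr t xi :
  duhamel V (fun s x => U s x + U' s x) t xi =
  duhamel V U t xi + duhamel V U' t xi.
Proof.
rewrite /duhamel -opprD; congr (- _).
rewrite -cintegralD//; first last.
- exact: integrable_duhamel fV fU'.
- exact: integrable_duhamel fV fU.
by apply: eq_cintegral => tau _; rewrite product_hatDr mulrDr.
Qed.

Lemma duhamelZl (a : R) t xi :
  duhamel (fun s x => a%:C * U s x) V t xi = a%:C * duhamel U V t xi.
Proof.
rewrite /duhamel mulrN -cintegralZ//; last exact: integrable_duhamel fU fV.
by congr (- _); apply: eq_cintegral => tau _; rewrite product_hatZl mulrCA.
Qed.

Lemma duhamelZr (a : R) t xi :
  duhamel V (fun s x => a%:C * U s x) t xi = a%:C * duhamel V U t xi.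
Proof.
rewrite /duhamel mulrN -cintegralZ//; last exact: integrable_duhamel fV fU.
by congr (- _); apply: eq_cintegral => tau _; rewrite product_hatZr mulrCA.
Qed.

End Bilinear.
End Duhamel.

(** * Completeness *)

Section Completeness.
Context {R : realType}.
Implicit Types (u : nat -> R -> R -> R[i]) (A C D : R).

Lemma le_of_geometric (x y C : R) : (forall n, x <= y + C / 2 ^+ n) -> x <= y.
Proof.
move=> h; rewrite leNgt; apply/negP => yx.
have C0 : 0 < C.
  by have := h 0%N; rewrite expr0 divr1; lra.
have xy0 : 0 < x - y by rewrite subr_gt0.
have [n hn] : exists n : nat, C / (x - y) < n%:R.
  by exists (Num.bound (C / (x - y))); exact: archi_boundP (ltW (divr_gt0 C0 xy0)).
have n2 : (n%:R : R) < 2 ^+ n by rewrite -natrX ltr_nat ltn_expl.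
have := h n; rewrite -lerBlDl ler_pdivlMr ?exprn_gt0//.
by apply/negP; rewrite -ltNge -ltr_pdivrMl// mulrC (lt_trans hn).
Qed.

(** The sequences [x n - 2 C / 2 ^ n] and [x n + 2 C / 2 ^ n] are adjacent. *)
Lemma geometric_cauchy (x : nat -> R) C :
  (forall n, `|x n.+1 - x n| <= C / 2 ^+ n) ->
  exists l, forall n, `|l - x n| <= 2 * C / 2 ^+ n.
Proof.
move=> h; pose d n := 2 * C / 2 ^+ n.
have dS n : d n.+1 = C / 2 ^+ n.
  by rewrite /d exprS -mulf_div divff ?mul1r// pnatr_eq0.
have dE n : d n = C / 2 ^+ n + C / 2 ^+ n by rewrite /d; ring.
have lo n m : (n <= m)%N -> x n - d n <= x m - d m.
  elim: m => [|m IH]; first by rewrite leqn0 => /eqP ->.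
  rewrite leq_eqVlt => /predU1P[->//|/IH/le_trans]; apply.
  by have := h m; rewrite ler_norml dS dE => /andP[]; lra.
have hi n m : (n <= m)%N -> x m + d m <= x n + d n.
  elim: m => [|m IH]; first by rewrite leqn0 => /eqP ->.
  rewrite leq_eqVlt => /predU1P[->//|/IH]; apply: le_trans.
  by have := h m; rewrite ler_norml dS dE => /andP[]; lra.
have C0 : 0 <= C by have := le_trans (normr_ge0 _) (h 0%N); rewrite expr0 divr1.
have d0 n : 0 <= d n by rewrite /d !mulr_ge0// invr_ge0 exprn_ge0.
have lohi n m : x n - d n <= x m + d m.
  have := lo _ _ (leq_maxl n m); have := hi _ _ (leq_maxr n m).
  have := d0 (maxn n m); lra.
pose E := range (fun n => x n - d n).
have ubE m : ubound E (x m + d m) by move=> _ [n _ <-]; exact: lohi.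
exists (sup E) => n; rewrite -/(d n) ler_distl; apply/andP; split.
  by apply: ub_le_sup; [exists (x n + d n)|exists n].
by apply: ge_sup => //; exists (x 0%N - d 0%N); exists 0%N.
Qed.

Lemma continuous_geometric_limit (g : R -> R) (f : nat -> R -> R) C :
  (forall n, continuous (f n)) ->
  (forall n x, `|g x - f n x| <= C / 2 ^+ n) -> continuous g.
Proof.
move=> cf h x; apply/cvgrPdist_lt => e e0.
have [n hn] : exists n, C / 2 ^+ n < e / 3.
  apply: contrapT => /forallNP hn.
  have : e / 3 <= 0 :> R.
    apply: (@le_of_geometric _ _ C) => n; rewrite add0r.
    by move/negP: (hn n); rewrite -leNgt.
  by lra.
have e3 : 0 < e / 3 by lra.
have /cvgrPdist_lt/(_ _ e3) := cf n x; apply: filterS => y hy.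
have := h n x; have := h n y; rewrite (distrC (g y)) => hy2 hx.
have -> : g x - g y = (g x - f n x) + (f n x - f n y) + (f n y - g y) by ring.
rewrite (le_lt_trans (ler_normD _ _))//.
have := ler_normD (g x - f n x) (f n x - f n y); lra.
Qed.

(** Completeness of the space of decaying trajectories, in the form needed by the
    Picard iteration. *)
Lemma decaying_limit u A D :
  (forall n, decaying A (u n)) ->
  (forall n, decaying (D / 2 ^+ n) (fun t xi => u n.+1 t xi - u n t xi)) ->
  exists2 U, decaying A U &
    forall n, decaying (4 * D / 2 ^+ n) (fun t xi => U t xi - u n t xi).
Proof.
move=> fu fd; have D0 : 0 <= D.
  by have := decaying_ge0 (fd 0%N); rewrite expr0 divr1.
have limit t xi : exists l, forall n,
    normc (l - u n t xi) <= 4 * D / 2 ^+ n * decay xi.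
  have step n := let: And4 b _ _ _ := fd n in b t xi.
  have [a ha] : exists a, forall n, `|a - complex.Re (u n t xi)| <=
      2 * (D * decay xi) / 2 ^+ n.
    apply: geometric_cauchy => n; rewrite mulrAC.
    by apply: le_trans (step n); rewrite -ReNc -ReDc Re_le_normc.
  have [b hb] : exists b, forall n, `|b - complex.Im (u n t xi)| <=
      2 * (D * decay xi) / 2 ^+ n.
    apply: geometric_cauchy => n; rewrite mulrAC.
    by apply: le_trans (step n); rewrite -ImNc -ImDc Im_le_normc.
  exists (a +i* b) => n; apply: le_trans (normc_le_ReIm _) _.
  rewrite ReDc ReNc ImDc ImNc.
  have -> : 4 * D / 2 ^+ n * decay xi = 2 * (D * decay xi) / 2 ^+ n +
     2 * (D * decay xi) / 2 ^+ n by ring.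
  by rewrite lerD.
have [U hU] := choice (fun p : R * R => limit p.1 p.2).
pose V t xi := U (t, xi); have {limit hU} hV n t xi :
  normc (V t xi - u n t xi) <= 4 * D / 2 ^+ n * decay xi by exact: (hU (t, xi)).
have hV1 n t xi : normc (V t xi - u n t xi) <= 4 * D / 2 ^+ n.
  apply: le_trans (hV n t xi) _; rewrite ler_piMr ?decay_le1//.
  by rewrite !mulr_ge0// invr_ge0 exprn_ge0.
have fV : decaying A V.
  split.
  - move=> t xi; apply: (@le_of_geometric _ _ (4 * D * decay xi)) => n.
    have [/(_ t xi) b _ _ _] := fu n.
    have := normcD (V t xi - u n t xi) (u n t xi); rewrite subrK.
    by move=> /le_trans; apply; rewrite addrC lerD// (le_trans (hV n t xi))// mulrAC.
  - move=> t; split; [apply: (@continuous_geometric_limit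
      (fun xi => complex.Re (V t xi))
      (fun n xi => complex.Re (u n t xi)) (4 * D)) => n|
      apply: (@continuous_geometric_limit
      (fun xi => complex.Im (V t xi))
      (fun n xi => complex.Im (u n t xi)) (4 * D)) => n].
    + by have [_ /(_ t)[? ?] _ _] := fu n.
    + by move=> xi; apply: le_trans (hV1 n t xi); rewrite -ReNc -ReDc Re_le_normc.
    + by have [_ /(_ t)[? ?] _ _] := fu n.
    + by move=> xi; apply: le_trans (hV1 n t xi); rewrite -ImNc -ImDc Im_le_normc.
  - move=> xi; split; [apply: (@continuous_geometric_limit
      (fun t => complex.Re (V t xi))
      (fun n t => complex.Re (u n t xi)) (4 * D)) => n|
      apply: (@continuous_geometric_limit
      (fun t => complex.Im (V t xi))
      (fun n t => complex.Im (u n t xi)) (4 * D)) => n].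
    + by have [_ _ /(_ xi)[? ?] _] := fu n.
    + by move=> t; apply: le_trans (hV1 n t xi); rewrite -ReNc -ReDc Re_le_normc.
    + by have [_ _ /(_ xi)[? ?] _] := fu n.
    + by move=> t; apply: le_trans (hV1 n t xi); rewrite -ImNc -ImDc Im_le_normc.
  - move=> t xi; apply/eqP; rewrite -subr_eq0; apply/eqP.
    apply: ComplexField.Normc.eq0_normc; apply/eqP.
    rewrite eq_le normc_ge0 andbT.
    apply: (@le_of_geometric _ _ (8 * D)) => n; rewrite add0r.
    have [_ _ _ hu] := fu n.
    have -> : V t (- xi) - conjc (V t xi) =
      (V t (- xi) - u n t (- xi)) - conjc (V t xi - u n t xi).
      by rewrite conjcD conjcN hu; ring.
    apply: le_trans (normcB _ _) _; rewrite normc_conj.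
    have := hV1 n t xi; have := hV1 n t (- xi).
    have -> : 8 * D / 2 ^+ n = 4 * D / 2 ^+ n + 4 * D / 2 ^+ n by ring.
    exact: lerD.
exists V => // n; have [_ cx ct hh] := decayingB fV (fu n).
by split.
Qed.

End Completeness.

(** * Quadratic equations with small data *)

Section QuadraticEquation.
Context {R : realType}.
Implicit Types (U V : R -> R -> R[i]) (A M : R).

Lemma decaying_ext A U V : (forall t xi, U t xi = V t xi) ->
  decaying A U -> decaying A V.
Proof. by move=> UV; have -> : U = V by apply/funext => t; apply/funext. Qed.

(* [B] is an arbitrary bounded bilinear map on the decaying trajectories, of
   norm at most [K]. *)
Variables (K : R) (B : (R -> R -> R[i]) -> (R -> R -> R[i]) -> R -> R -> R[i]).
Hypothesis K0 : 0 <= K.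
Hypothesis decaying_B : forall A M U V, decaying A U -> decaying M V ->
  decaying (K * (A * M)) (B U V).
Hypothesis BDl : forall A A' M U U' V,
  decaying A U -> decaying A' U' -> decaying M V ->
  forall t xi, B (fun s x => U s x + U' s x) V t xi = B U V t xi + B U' V t xi.
Hypothesis BDr : forall A A' M U U' V,
  decaying A U -> decaying A' U' -> decaying M V ->
  forall t xi, B V (fun s x => U s x + U' s x) t xi = B V U t xi + B V U' t xi.
Hypothesis BZl : forall A M U V, decaying A U -> decaying M V ->
  forall (b : R) t xi,
  B (fun s x => b%:C * U s x) V t xi = b%:C * B U V t xi.
Hypothesis BZr : forall A M U V, decaying A U -> decaying M V ->
  forall (b : R) t xi,
  B V (fun s x => b%:C * U s x) t xi = b%:C * B V U t xi.

(** The Leibniz rule [B U V - B U' V' = B (U - U') V + B U' (V - V')]. *)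
Lemma decaying_BB A M A' M' D E U U' V V' :
  decaying A U -> decaying M V -> decaying A' U' -> decaying M' V' ->
  decaying D (fun t xi => U t xi - U' t xi) ->
  decaying E (fun t xi => V t xi - V' t xi) ->
  decaying (K * (D * M) + K * (A' * E)) (fun t xi => B U V t xi - B U' V' t xi).
Proof.
move=> fU fV fU' fV' fD fE.
apply: (@decaying_ext _ (fun t xi =>
  B (fun s x => U s x - U' s x) V t xi +
  B U' (fun s x => V s x - V' s x) t xi)); last first.
  by apply: decayingD; apply: decaying_B.
move=> t xi.
have UE W W' : (fun s x => W s x - W' s x + W' s x) = W :> (R -> R -> R[i]).
  by apply/funext => s; apply/funext => x; rewrite subrK.
have := BDl fD fU' fV t xi; rewrite (UE U U') => ->.
have := BDr fE fV' fU' t xi; rewrite (UE V V') => ->.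
by rewrite addrA addrK.
Qed.

Variables (a : R) (F : R -> R -> R[i]).
Hypothesis fF : decaying a F.

(** The solutions of the quadratic equation in the ball where the fixed-point map
    is a contraction. *)
Definition mild eps U :=
  decaying (2 * `|eps| * a) U /\
  forall t xi, U t xi = eps%:C * F t xi + B U U t xi.

(** Picard iteration.  The smallness of [eps] makes the iterates stay in the ball
    of radius [2 |eps| a] and their increments at least halve at each step. *)
Lemma mild_exists eps : 8 * K * a * `|eps| <= 1 -> exists U, mild eps U.
Proof.
have a0 := decaying_ge0 fF.
set r := `|eps| * a => small.
have r0 : 0 <= r by rewrite mulr_ge0.
have small' : 8 * K * r <= 1 by rewrite /r; lra.
have Kr0 : 0 <= K * r by rewrite mulr_ge0.
have Kr2 : K * r * r <= r / 8 by nra.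
have f0 : decaying r (fun t xi => eps%:C * F t xi) by exact: decayingZ.
have [u [u0 uS]] : exists u : nat -> R -> R -> R[i],
    (u 0%N = fun t xi => eps%:C * F t xi) /\
    (forall n, u n.+1 = fun t xi => eps%:C * F t xi + B (u n) (u n) t xi).
  by exists (fix u n := if n is m.+1 then
      fun t xi => eps%:C * F t xi + B (u m) (u m) t xi
    else fun t xi => eps%:C * F t xi).
have fu n : decaying (2 * r) (u n).
  elim: n => [|n IH]; first by rewrite u0; apply: decaying_le f0; lra.
  rewrite uS.
  by apply: decaying_le (decayingD f0 (decaying_B IH IH)); nra.
have fd n : decaying (r / 2 ^+ n) (fun t xi => u n.+1 t xi - u n t xi).
  elim: n => [|n IH].
    rewrite expr0 divr1.
    apply: (@decaying_ext _ (B (u 0%N) (u 0%N))).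
      by move=> t xi; rewrite uS {5}u0 addrC addKr.
    by apply: decaying_le (decaying_B (fu _) (fu _)); nra.
  apply: (@decaying_ext _
    (fun t xi => B (u n.+1) (u n.+1) t xi - B (u n) (u n) t xi)).
    move=> t xi; rewrite (congr1 (fun f => f t xi) (uS n.+1)).
    rewrite (congr1 (fun f => f t xi) (uS n)).
    move: (B (u n.+1) _ t xi) (B (u n) _ t xi) (eps%:C * _) => x y z.
    by ring.
  apply: decaying_le (decaying_BB (fu _) (fu _) (fu _) (fu _) IH IH).
  have i0 : 0 <= r / 2 ^+ n by rewrite divr_ge0// exprn_ge0.
  rewrite exprS invfM; move: i0.
  set q := (2 ^+ n)^-1 => q0.
  have : K * r * (r * q) <= r * q / 8 by nra.
  by lra.
have [U fU hU] := decaying_limit fu fd.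
exists U; split; first by apply: decaying_le fU; rewrite /r; lra.
move=> t xi; apply/eqP; rewrite -subr_eq0; apply/eqP.
apply: ComplexField.Normc.eq0_normc; apply/eqP.
rewrite eq_le normc_ge0 andbT.
apply: (@le_of_geometric _ _ _ (6 * r * decay xi)) => n; rewrite add0r.
have -> : U t xi - (eps%:C * F t xi + B U U t xi) =
   (U t xi - u n.+1 t xi) - (B U U t xi - B (u n) (u n) t xi).
  rewrite [u n.+1]uS.
  move: (B U U t xi) (B _ _ t xi) (eps%:C * _) => x y z.
  by ring.
have [b1 _ _ _] := hU n.+1.
have [b2 _ _ _] := decaying_BB fU fU (fu n) (fu n) (hU n) (hU n).
apply: le_trans (normcB _ _) _; apply: le_trans (lerD (b1 t xi) (b2 t xi)) _.
rewrite -mulrDl [leRHS]mulrAC; apply: ler_wpM2r; first exact: decay_ge0.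
rewrite exprS invfM.
have i0 : 0 <= r / 2 ^+ n by rewrite divr_ge0// exprn_ge0.
move: i0; set q := (2 ^+ n)^-1 => q0.
have : K * r * (r * q) <= r * q / 8 by nra.
by lra.
Qed.

(** The difference [d] of the solutions satisfies
    [d = (eps - eps') F + B d U + B U' d], where the last two terms have at most
    half the size of [d]; a bound [2 |eps - eps'| a + M] on [d] thus improves to
    [2 |eps - eps'| a + M / 2], and so on. *)
Lemma mild_lipschitz eps eps' U U' :
  8 * K * a * `|eps| <= 1 -> 8 * K * a * `|eps'| <= 1 ->
  mild eps U -> mild eps' U' ->
  decaying (2 * `|eps - eps'| * a) (fun t xi => U t xi - U' t xi).
Proof.
move=> se se' [fU eU] [fU' eU'].
have a0 := decaying_ge0 fF.
pose d := `|eps - eps'| * a; have d0 : 0 <= d by rewrite mulr_ge0.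
pose M := 2 * `|eps| * a + 2 * `|eps'| * a.
have M0 : 0 <= M by rewrite addr_ge0 ?mulr_ge0.
have KM : K * M <= 1 / 2 by rewrite /M; lra.
have fn n : decaying (2 * d + M / 2 ^+ n) (fun t xi => U t xi - U' t xi).
  elim: n => [|n IH].
    rewrite expr0 divr1; apply: decaying_le (decayingB fU fU'); rewrite -/M; lra.
  apply: (@decaying_ext _ (fun t xi => (eps - eps')%:C * F t xi +
    (B U U t xi - B U' U' t xi))).
    move=> t xi; rewrite [in RHS]eU [in RHS]eU' rmorphB/= mulrBl.
    by rewrite opprD addrACA.
  apply: decaying_le (decayingD (decayingZ _ fF)
    (decaying_BB fU fU fU' fU' IH IH)).
  rewrite -/d exprS invfM.
  have i0 : 0 <= M / 2 ^+ n by rewrite divr_ge0// exprn_ge0.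
  move: i0; set q := _^-1 => q0.
  have -> : K * ((2 * d + M * q) * (2 * `|eps| * a)) +
    K * (2 * `|eps'| * a * (2 * d + M * q)) = K * M * (2 * d + M * q).
    by rewrite /M; ring.
  nra.
have [b cx ct h] := fn 0%N; split=> // t xi.
apply: (@le_of_geometric _ _ _ (M * decay xi)) => n.
have [/(_ t xi) /le_trans bn _ _ _] := fn n; apply: bn.
by rewrite le_eqVlt; apply/orP; left; apply/eqP; rewrite /d; ring.
Qed.

(** With [e = B U U], the remainder of the expansion of one solution is
    [B U U - eps ^ 2 B F F = B e U + B (eps F) e].  Every factor here is Lipschitz
    in [eps], and has the size of a power of [eps] one higher than its Lipschitz
    constant; hence the remainder is Lipschitz with a constant of second
    order. *)
Lemma mild_expansion eps eps' U U' :
  8 * K * a * `|eps| <= 1 -> 8 * K * a * `|eps'| <= 1 ->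
  mild eps U -> mild eps' U' ->
  decaying (24 * K ^+ 2 * a ^+ 3 * `|eps - eps'| * (`|eps| + `|eps'|) ^+ 2)
    (fun t xi => U t xi - U' t xi - (eps - eps')%:C * F t xi -
       (eps ^+ 2 - eps' ^+ 2)%:C * B F F t xi).
Proof.
move=> se se' mU mU'; have fd := mild_lipschitz se se' mU mU'.
have a0 := decaying_ge0 fF.
have [fU eU] := mU; have [fU' eU'] := mU'.
have fe := decaying_B fU fU.
have fe' := decaying_B fU' fU'.
have fde := decaying_BB fU fU fU' fU' fd fd.
have fz := decayingZ eps fF; have fz' := decayingZ eps' fF.
have fdz : decaying (`|eps - eps'| * a)
    (fun t xi => eps%:C * F t xi - eps'%:C * F t xi).
  apply: decaying_ext (decayingZ (eps - eps') fF) => t xi.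
  by rewrite rmorphB/= mulrBl.
have split_square e V : decaying (2 * `|e| * a) V ->
    (forall t xi, V t xi = e%:C * F t xi + B V V t xi) ->
    forall t xi, B V V t xi = (e ^+ 2)%:C * B F F t xi +
      (B (B V V) V t xi + B (fun s x => e%:C * F s x) (B V V) t xi).
  move=> fV eV t xi; have fe0 := decaying_B fV fV.
  have fz0 := decayingZ e fF.
  have VE : V = (fun s x => e%:C * F s x + B V V s x).
    by apply/funext => s; apply/funext => x; exact: eV.
  have e1 : B V V t xi = B (fun s x => e%:C * F s x) V t xi + B (B V V) V t xi.
    by rewrite {1}VE; exact: (BDl fz0 fe0 fV).
  have e2 : B (fun s x => e%:C * F s x) V t xi =
      B (fun s x => e%:C * F s x) (fun s x => e%:C * F s x) t xi +
      B (fun s x => e%:C * F s x) (B V V) t xi.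
    by rewrite {1}VE; exact: (BDr fz0 fe0 fz0).
  have e3 : B (fun s x => e%:C * F s x) (fun s x => e%:C * F s x) t xi =
      e%:C * (e%:C * B F F t xi).
    by rewrite (BZr fF fz0) (BZl fF fF).
  rewrite e1 e2 e3 rmorphXn/=.
  move: (B F F t xi) (B _ (B V V) t xi) (B (B V V) V t xi) => x y z.
  by ring.
have := decayingD (decaying_BB fe fU fe' fU' fde fd)
  (decaying_BB fz fe fz' fe' fdz fde).
move=> h; apply: decaying_le (decaying_ext _ h).
  set x := `|eps - eps'|; set y := `|eps|; set y' := `|eps'|.
  have x0 : 0 <= x := normr_ge0 _.
  have y0 : 0 <= y := normr_ge0 _.
  have y0' : 0 <= y' := normr_ge0 _.
  have : 0 <= K ^+ 2 * a ^+ 3 * x.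
    by apply: mulr_ge0 => //; apply: mulr_ge0; exact: exprn_ge0.
  set k := K ^+ 2 * a ^+ 3 * x => k0.
  rewrite -subr_ge0.
  set Z := (Z in 0 <= Z).
  have -> : Z = k * (24 * (y + y') ^+ 2 - (8 * (y + y') * y + 8 * y' ^+ 2 +
     4 * y ^+ 2 + 4 * y' * (y + y'))) by rewrite /Z /k; ring.
  apply: mulr_ge0 => //; nra.
move=> t xi; rewrite eU eU' (split_square eps U fU eU).
rewrite (split_square eps' U' fU' eU') !rmorphB/=.
move: (B _ (B U U) t xi) => x1; move: (B _ (B U' U') t xi) => x2.
move: (B (B U U) U t xi) => x3; move: (B (B U' U') U' t xi) => x4.
move: (B F F t xi) (F t xi) => x5 x6; ring.
Qed.

End QuadraticEquation.

(** * Sobolev norms *)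

Section SobolevNorm.
Context {R : realType}.
Notation mu1 := (@lebesgue_measure R).
Implicit Types (f g : R -> R[i]) (s xi A : R).

Definition sobolev_weight s xi : R := (1 + xi ^+ 2) `^ (s / 2).

Lemma sobolev_weight_ge0 s xi : 0 <= sobolev_weight s xi.
Proof. exact: powR_ge0. Qed.

Lemma sqr_sobolev_weight s xi : sobolev_weight s xi ^+ 2 = (1 + xi ^+ 2) `^ s.
Proof.
by rewrite -powR_mulrn ?powR_ge0// /sobolev_weight -powRrM divfK.
Qed.

Lemma measurable_sobolev_weight s : measurable_fun setT (sobolev_weight s).
Proof.
apply: (@measurableT_comp _ _ _ _ _ _ (fun x : R => x `^ (s / 2))).
  exact: measurable_powR.
by apply: measurable_funD => //; exact: measurable_funX.
Qed.

Let energy s f xi := (sobolev_weight s xi * normc (f xi)) ^+ 2.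

Lemma energy_ge0 s f xi : 0 <= energy s f xi.
Proof. exact: sqr_ge0. Qed.

Lemma measurable_energy s f : cmeasurable f -> measurable_fun setT (energy s f).
Proof.
move=> mf; apply: measurable_funX; apply: measurable_funM.
  exact: measurable_sobolev_weight.
exact: measurable_normc.
Qed.

Lemma Hs_normE s f :
  Hs_norm s f = ((\int[mu1]_xi (energy s f xi)%:E) `^ 2^-1)%E.
Proof.
rewrite /Hs_norm unlock; congr poweR; apply: eq_integral => xi _.
have p0 : 0 <= (1 + xi ^+ 2) `^ (s / 2) * normc (f xi).
  by rewrite mulr_ge0 ?powR_ge0 ?normc_ge0.
by rewrite /= ger0_norm// powR_mulrn.
Qed.

Lemma Hs_norm_ge0 s f : (0 <= Hs_norm s f)%E.
Proof. by rewrite Hs_normE poweR_ge0. Qed.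

Lemma Hs_norm_sqrt s f : mu1.-integrable setT (EFin \o energy s f) ->
  Hs_norm s f = (Num.sqrt (\int[mu1]_xi energy s f xi))%:E.
Proof.
move=> ie; rewrite Hs_normE -(@fineK _ (\int[mu1]_xi _)%E); last first.
  exact: integrable_fin_num.
rewrite poweR_EFin powR12_sqrt// fine_ge0// integral_ge0// => x _.
by rewrite lee_fin energy_ge0.
Qed.

(** Elements of the Sobolev space are only defined almost everywhere. *)
Lemma ae_eq_Hs_norm s f g : cmeasurable f -> cmeasurable g ->
  {ae mu1, forall xi, f xi = g xi} -> Hs_norm s f = Hs_norm s g.
Proof.
move=> mf mg fg; rewrite !Hs_normE; congr poweR.
apply: ae_eq_integral => //.
- by apply/measurable_EFinP; exact: measurable_energy.
- by apply/measurable_EFinP; exact: measurable_energy.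
have [N [mN N0 subN]] := fg; exists N; split => // x /= nx.
by apply: subN => /= fgx; apply: nx => _; rewrite /energy fgx.
Qed.

Lemma Hs_normN s f : Hs_norm s (- f) = Hs_norm s f.
Proof.
by rewrite !Hs_normE; congr poweR; apply: eq_integral => x _;
  rewrite /energy normcN.
Qed.

Lemma Hs_normD s f g : cmeasurable f -> cmeasurable g ->
  (Hs_norm s (f + g)%R <= Hs_norm s f + Hs_norm s g)%E.
Proof.
move=> mf mg.
pose F f := fun xi => sobolev_weight s xi * normc (f xi).
have mF h : cmeasurable h -> measurable_fun setT (F h).
  move=> mh; apply: measurable_funM; last exact: measurable_normc.
  exact: measurable_sobolev_weight.
have := @minkowski_EFin _ _ _ mu1 (F f) (F g) 2 (mF _ mf) (mF _ mg) (ler1n _ 2).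
apply: le_trans; rewrite /Hs_norm unlock.
have F0 h xi : 0 <= F h xi by rewrite mulr_ge0 ?powR_ge0 ?normc_ge0.
apply: gt0_ler_poweR; first by rewrite invr_ge0.
- rewrite in_itv/= leey andbT; apply: integral_ge0 => x _.
  by rewrite lee_fin powR_ge0.
- rewrite in_itv/= leey andbT; apply: integral_ge0 => x _.
  by rewrite lee_fin powR_ge0.
have mP (h : R -> R) : measurable_fun setT h ->
    measurable_fun setT (fun x => (`|(h x)%:E| `^ 2)%E).
  move=> mh.
  rewrite [X in measurable_fun _ X](_ : _ = EFin \o (fun x => `|h x| `^ 2))//.
  apply/measurable_EFinP.
  apply: (@measurableT_comp _ _ _ _ _ _ (fun x : R => x `^ 2)).
    exact: measurable_powR.
  exact: measurableT_comp.
apply: ge0_le_integral => //.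
- by move=> x _; exact: poweR_ge0.
- exact: (mP (F (f + g)) (mF _ (cmeasurableD mf mg))).
- by apply: (mP (fun x => F f x + F g x)); apply: measurable_funD; exact: mF.
move=> x _ /=; rewrite lee_fin.
apply: ge0_ler_powR; rewrite ?nnegrE//.
rewrite !ger0_norm ?addr_ge0 ?F0// -?mulrDr.
by rewrite ler_wpM2l ?powR_ge0 ?normcD.
Qed.

Lemma Hs_normZ s (a : R) f : cmeasurable f ->
  Hs_norm s (rscale a f) = (`|a|%:E * Hs_norm s f)%E.
Proof.
move=> mf; rewrite !Hs_normE.
under eq_integral => x _.
  have -> : energy s (rscale a f) x = `|a| ^+ 2 * energy s f x.
    rewrite /energy /rscale ComplexField.Normc.normcM normc_real -exprMn.
    by congr (_ ^+ _); ring.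
  rewrite EFinM.
  over.
rewrite ge0_integralZl//; last 2 first.
- by apply/measurable_EFinP; exact: measurable_energy.
- by move=> x _; rewrite lee_fin energy_ge0.
rewrite poweRM ?lee_fin ?sqr_ge0//; last first.
  by apply: integral_ge0 => x _; rewrite lee_fin energy_ge0.
by rewrite poweR_EFin powR12_sqrt ?sqr_ge0// sqrtr_sqr normr_id.
Qed.

(** For [q >= 1], [1 + r <= q (1 + r / q) <= q exp (r / q)], whence
    [(1 + r) ^ q <= q ^ q exp r]. *)
Lemma polynomial_le_expR (p : R) : exists2 C : R, 0 <= C &
  forall xi : R, (1 + xi ^+ 2) `^ p * expR (- `|xi|) ^+ 2 <= C.
Proof.
pose n := (Num.bound `|p|).+1.
have pn : p <= n%:R.
  rewrite (le_trans (ler_norm p))// ltW// (lt_trans (archi_boundP (normr_ge0 _)))//.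
  by rewrite ltr_nat.
pose q : R := (n * 2)%:R.
have q1 : 1 <= q by rewrite ler1n muln_gt0.
have q0 : 0 < q by rewrite (lt_le_trans _ q1).
exists (q ^+ (n * 2)); first by rewrite exprn_ge0// ltW.
move=> xi; rewrite -(real_normK (num_real xi)); have := normr_ge0 xi.
move: `|xi| => r r0.
apply: (@le_trans _ _ (q ^+ (n * 2) * expR r * expR (- r) ^+ 2)); last first.
  rewrite -mulrA ler_piMr ?exprn_ge0 ?(ltW q0)//.
  by rewrite expr2 mulrA -expRD subrr expR0 mul1r -expR0 ler_expR oppr_le0.
rewrite ler_wpM2r ?sqr_ge0//.
apply: (@le_trans _ _ ((1 + r ^+ 2) `^ n%:R)).
  by apply: ler_powR => //; rewrite lerDl sqr_ge0.
rewrite powR_mulrn ?addr_ge0 ?sqr_ge0//.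
apply: (@le_trans _ _ (((1 + r) ^+ 2) ^+ n)).
  by rewrite lerXn2r ?nnegrE ?addr_ge0 ?sqr_ge0//; nra.
rewrite -exprM mulnC.
have -> : expR r = expR (r / q) ^+ (n * 2).
  by rewrite -expRM_natr -/q divfK ?gt_eqF.
rewrite -exprMn lerXn2r ?nnegrE ?addr_ge0 ?mulr_ge0 ?expR_ge0 ?(ltW q0)//.
have := ler_wpM2l (ltW q0) (expR_ge1Dx (r / q)).
by apply: le_trans; rewrite mulrDr mulr1 mulrCA divff ?gt_eqF// mulr1 lerD2r.
Qed.

Lemma integrable_decay_energy s A :
  mu1.-integrable setT
    (EFin \o (fun xi => (sobolev_weight s xi * (A * decay xi)) ^+ 2)).
Proof.
have [C C0 hC] := polynomial_le_expR (s + 1).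
apply: (@integrable_dominated _ _ (fun xi => (A ^+ 2 * C) * lorentz xi)) => //.
- apply: measurable_funX; apply: measurable_funM.
    exact: measurable_sobolev_weight.
  apply: measurable_funM => //; apply: measurable_funM.
    apply: continuous_measurable_fun; apply: continuous_expR_comp => x.
    by apply: cvgN; exact: norm_continuous.
  apply: continuous_measurable_fun => x; apply: cvgV.
    by rewrite gt_eqF// ltr_wpDr// exprn_ge0.
  apply: cvgD; first exact: cvg_cst.
  apply: (@continuous_comp _ _ _ (fun y : R => `|y|) (fun y => y ^+ 3)).
    exact: norm_continuous.
  exact: exprn_continuous.
- apply: integrable_scale => //; exact: integrable_lorentz.
move=> xi _; rewrite ger0_norm ?sqr_ge0// exprMn sqr_sobolev_weight exprMn.
rewrite mulrCA -mulrA ler_wpM2l ?sqr_ge0//.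
have x1 : 0 < 1 + xi ^+ 2 by rewrite ltr_wpDr// sqr_ge0.
have := hC xi; rewrite powRD ?powRr1 ?(ltW x1)//; last first.
  by rewrite (gt_eqF x1) implybT.
set P := _ `^ s => hP.
have P0 : 0 <= P by exact: powR_ge0.
rewrite /lorentz [leRHS]mulrA ler_pdivlMr//.
apply: (@le_trans _ _ (P * (1 + xi ^+ 2) * expR (- `|xi|) ^+ 2)); last lra.
have -> : P * decay xi ^+ 2 * (1 + xi ^+ 2) =
  P * (1 + xi ^+ 2) * decay xi ^+ 2 by ring.
apply: ler_wpM2l; first by rewrite mulr_ge0// ltW.
rewrite /decay expr_div_n ler_pdivrMr ?exprn_gt0 ?ltr_wpDr ?exprn_ge0//.
rewrite ler_peMr ?sqr_ge0// exprn_ege1// lerDl exprn_ge0//.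
Qed.

End SobolevNorm.

(** * Second-order expansions of C^2 maps *)

Section SecondOrder.
Context {R : realType}.
Variables (realv : bool) (s : R).
Implicit Types (f g h : R -> R[i]) (a : R).

Local Notation H := (Hs false s).
Let N f : R := fine (Hs_norm s f).

(** The estimates below only involve norms, so they may be made in the larger
    space of complex-valued distributions. *)
Lemma Hs_weaken f : Hs realv s f -> H f.
Proof. by move=> [mf nf _]; split. Qed.

Lemma Hs_norm_fine f : H f -> Hs_norm s f = (N f)%:E.
Proof.
by move=> [_ nf _]; rewrite fineK// ge0_fin_numE// Hs_norm_ge0.
Qed.

Lemma hnorm_ge0 f : 0 <= N f.
Proof. by rewrite fine_ge0// Hs_norm_ge0. Qed.

Lemma HsD f g : H f -> H g -> H (f + g).
Proof.
move=> [mf nf _] [mg ng _]; split => //; first exact: cmeasurableD.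
by rewrite (le_lt_trans (Hs_normD _ _ _))// lte_add_pinfty.
Qed.

Lemma HsN f : H f -> H (- f).
Proof.
move=> [mf nf _]; split => //; first exact: cmeasurableN.
by rewrite Hs_normN.
Qed.

Lemma HsB f g : H f -> H g -> H (f - g).
Proof. by move=> hf hg; apply: HsD => //; exact: HsN. Qed.

Lemma Hs_scale r a f : Hs r s f -> Hs r s (rscale a f).
Proof.
move=> [mf nf hf]; split; first exact: cmeasurable_rscale.
  by rewrite Hs_normZ// lte_mul_pinfty// lee_fin.
move=> /hf [A [mA A0 subA]]; exists A; split=> // x /= nx; apply: subA => /= e.
by apply: nx; rewrite /rscale e conjcM conjc_rC.
Qed.

Lemma hnormD f g : H f -> H g -> N (f + g) <= N f + N g.
Proof.
move=> hf hg; have [mf _ _] := hf; have [mg _ _] := hg.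
rewrite -lee_fin EFinD -!Hs_norm_fine//; [exact: Hs_normD|exact: HsD].
Qed.

Lemma hnormN f : N (- f) = N f.
Proof. by rewrite /N Hs_normN. Qed.

Lemma hnormB f g : H f -> H g -> N (f - g) <= N f + N g.
Proof. by move=> hf hg; rewrite -(hnormN g); apply: hnormD => //; exact: HsN. Qed.

Lemma hnormZ a f : H f -> N (rscale a f) = `|a| * N f.
Proof.
move=> hf; have [mf _ _] := hf.
by rewrite /N Hs_normZ// Hs_norm_fine.
Qed.

Lemma Hs0 r : Hs r s 0.
Proof.
have c0 : ccont (0 : R -> R[i]) by exact: (ccont_cst (0 : R[i])).
split; first exact: ccont_measurable.
  rewrite (_ : 0 = rscale 0 0); last first.
    by apply/funext => x; rewrite /rscale mulr0.
  by rewrite Hs_normZ ?normr0 ?mul0e//; exact: ccont_measurable.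
by move=> _; apply: aeW => x /=; rewrite oppr0.
Qed.

Lemma hnorm0 : N 0 = 0.
Proof.
have -> : 0 = rscale 0 0 :> (R -> R[i]).
  by apply/funext => x; rewrite /rscale mulr0.
by rewrite hnormZ ?normr0 ?mul0r//; exact: Hs0.
Qed.

(** Homogeneity is obtained by additivity with the zero vector, whose image has
    norm zero by boundedness. *)
Lemma bounded_linear_scale A a h : bounded_linear realv s A -> Hs realv s h ->
  N (A (rscale a h) - rscale a (A h)) = 0.
Proof.
move=> [AH AL [C AC]] hh.
have h0 := Hs0 realv; have hah := Hs_scale a hh.
have H0 := Hs_weaken (AH _ h0); have H1 := Hs_weaken (AH _ hh).
have H2 := Hs_weaken (AH _ hah); have H3 := Hs_scale a H1.
have A0 : N (A 0) = 0.
  apply/eqP; rewrite eq_le hnorm_ge0 andbT -lee_fin -Hs_norm_fine//.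
  by rewrite (le_trans (AC _ h0))// Hs_norm_fine ?hnorm0 ?mule0//; exact: Hs0.
have := AL a _ _ hh h0; rewrite addr0 => e.
apply/eqP; rewrite eq_le hnorm_ge0 andbT.
have -> : A (rscale a h) - rscale a (A h) =
    (A (rscale a h) - (rscale a (A h) + A 0)) + A 0 by rewrite opprD addrA subrK.
apply: le_trans (hnormD _ _) _ => //; first by apply: HsB => //; exact: HsD.
by rewrite A0 addr0 /N e.
Qed.

Lemma le_of_small (x y C e0 : R) : 0 < e0 ->
  (forall e, 0 < e -> e < e0 -> x <= y + C * e) -> x <= y.
Proof.
move=> e00 h; rewrite leNgt; apply/negP => yx.
pose c := `|C| + 1; have c0 : 0 < c by rewrite ltr_wpDl.
pose e := Num.min (e0 / 2) ((x - y) / (2 * c)).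
have xy : 0 < x - y by rewrite subr_gt0.
have e1 : 0 < e.
  by rewrite lt_min; apply/andP; split; rewrite divr_gt0// mulr_gt0.
have e2 : e < e0.
  have : e <= e0 / 2 by rewrite ge_min lexx.
  by lra.
have e3 : e * (2 * c) <= x - y.
  by rewrite -ler_pdivlMr ?mulr_gt0// ge_min lexx orbT.
have := h _ e1 e2; have : C <= c by rewrite /c (le_trans (ler_norm C))// lerDl.
nra.
Qed.

(** Differentiating the expansion once, at [e h] in the direction [h], gives
    [F1 (e h) h = G + 2 e S + O (e ^ 2)].  The definition of [F2 0], with the
    tolerance 1, bounds [F1 (e h) h - F1 0 h - e F2 0 h h] by [e ||h|| ^ 2];
    dividing by [e] and letting it tend to zero, one bounds [2 S] by the norm of
    the bilinear map [F2 0], increased by 1, times [||h|| ^ 2]. *)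
Lemma C2_second_order D F : Hs_open realv s D -> D (fun=> 0) ->
  C2_on realv s D F -> exists2 C : R, 0 <= C & forall h G S C3 e0,
    Hs realv s h -> H G -> H S -> 0 <= C3 -> 0 < e0 ->
    (forall e e', 0 <= e < e0 -> 0 <= e' < e0 ->
      D (rscale e h) -> D (rscale e' h) ->
      N (F (rscale e h) - F (rscale e' h) - rscale (e - e') G -
         rscale (e ^+ 2 - e' ^+ 2) S) <= C3 * `|e - e'| * (e + e') ^+ 2) ->
    N S <= C * N h ^+ 2.
Proof.
move=> [DH openD] D0 [FH [F1 [F2 [lin dif1 dif2 _]]]].
have [lin1 [F2l F2lin [C2 F2b]]] := lin _ D0.
exists (`|C2| + 1); first by rewrite addr_ge0.
move=> h G S C3 e0 hh hG hS C30 e00 expansion.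
have Hh := Hs_weaken hh; have n0 := hnorm_ge0 h; have nS := hnorm_ge0 S.
have [r r0 hr] := openD _ D0.
have HF x : D x -> H (F x) by move=> /FH/Hs_weaken.
have scale0 : rscale 0 h = (fun=> 0).
  by apply/funext => x; rewrite /rscale mul0r.
have scaleB a b : rscale a h - rscale b h = rscale (a - b) h.
  by apply/funext => x; rewrite /rscale/= !fctE rmorphB/= mulrBl.
have small_in e : 0 <= e -> e * (N h + 1) < r -> D (rscale e h).
  move=> e1 er; apply: hr; first exact: Hs_scale.
  rewrite -scale0 scaleB subr0 Hs_norm_fine ?lte_fin; last exact: Hs_scale.
  rewrite hnormZ// ger0_norm//; nra.
pose e1 := Num.min e0 (r / (N h + 1)).
have n1 : 0 < N h + 1 by rewrite ltr_wpDl.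
have e10 : 0 < e1 by rewrite lt_min e00 divr_gt0.
have e1e0 : e1 <= e0 by rewrite ge_min lexx.
have De e : 0 <= e -> e < e1 -> D (rscale e h).
  move=> ep ee; apply: small_in => //; rewrite -ltr_pdivlMr//.
  by apply: lt_le_trans ee _; rewrite ge_min lexx orbT.
(* The derivative of [F] along the segment, up to an arbitrary error [eta]: it is
   approximated by a difference quotient with a step [q] small compared to
   [eta]. *)
have der e eta : 0 <= e -> e < e1 -> 0 < eta ->
    N (F1 (rscale e h) h - G - rscale (2 * e) S) <= 8 * C3 * e ^+ 2 + eta.
  move=> ep ee eta0; have Dx := De _ ep ee.
  have [linx _] := lin _ Dx; have [F1H _ _] := linx.
  pose k := eta / (2 * (N h + 1)).
  have k0 : 0 < k by rewrite divr_gt0// mulr_gt0.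
  have kE : k * (N h + 1) = eta / 2 by rewrite /k invfM mulrA mulfVK ?gt_eqF.
  have [d d0 hd] := dif1 _ Dx _ k0.
  pose c := 2 * C3 + N S + 1.
  have c0 : 0 < c by rewrite ltr_wpDl// addr_ge0// mulr_ge0.
  pose m := Num.min (Num.min 1 (e1 - e)) (Num.min (d / (N h + 1)) (eta / (2 * c))).
  have m0 : 0 < m.
    rewrite !lt_min ltr01 subr_gt0 ee /=.
    by rewrite !divr_gt0// mulr_gt0.
  have m1 : m <= 1 by rewrite !ge_min lexx.
  have me : m <= e1 - e by rewrite !ge_min lexx orbT.
  have md : m <= d / (N h + 1) by rewrite !ge_min lexx !orbT.
  have mc : m <= eta / (2 * c) by rewrite !ge_min lexx !orbT.
  pose q := m / 2; have q0 : 0 < q by rewrite /q; lra.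
  have qm : q < m by rewrite /q; lra.
  have eq1 : e + q < e1 by lra.
  have Dy := De _ (addr_ge0 ep (ltW q0)) eq1.
  have qd : q * (N h + 1) < d by rewrite -ltr_pdivlMr//; lra.
  have qc : q * c <= eta / 2.
    have : m * (2 * c) <= eta by rewrite -ler_pdivlMr ?mulr_gt0.
    by rewrite /q; nra.
  have yx : rscale (e + q) h - rscale e h = rscale q h.
    by rewrite scaleB addrAC subrr add0r.
  have Hq : Hs realv s (rscale q h) by exact: Hs_scale.
  have := hd _ Dy; rewrite yx Hs_norm_fine ?hnormZ// ?(gtr0_norm q0); last first.
    exact: Hs_weaken.
  rewrite lte_fin => /(_ _)/wrap[]; first by nra.
  have h1 : H (F1 (rscale e h) (rscale q h)) by exact/Hs_weaken/F1H.
  have h2 : H (F1 (rscale e h) h) by exact/Hs_weaken/F1H.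
  have hy := HF _ Dy; have hx := HF _ Dx.
  rewrite Hs_norm_fine -?EFinM ?lee_fin; last exact: (HsB (HsB hy hx) h1).
  move=> b1.
  have b2 := bounded_linear_scale q linx hh.
  have eI : 0 <= e + q < e0 by apply/andP; split; lra.
  have eI' : 0 <= e < e0 by apply/andP; split; lra.
  have b3 := expansion _ _ eI eI' Dy Dx.
  have eqe : e + q - e = q by ring.
  rewrite eqe (gtr0_norm q0) in b3.
  have hGS := Hs_scale ((e + q) ^+ 2 - e ^+ 2) hS.
  have hGq := Hs_scale q hG.
  set f1 := (X in N X <= _) in b1; set f2 := (X in N X = _) in b2.
  set f3 := (X in N X <= _) in b3.
  have H1 : H f1 by exact: (HsB (HsB hy hx) h1).
  have H2 : H f2 by exact: (HsB h1 (Hs_scale q h2)).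
  have H3 : H f3 by exact: (HsB (HsB (HsB hy hx) hGq) hGS).
  have H4 : H (F1 (rscale e h) h - G - rscale (2 * e) S).
    by apply: HsB; [exact: HsB|exact: Hs_scale].
  have id1 : rscale q (F1 (rscale e h) h - G - rscale (2 * e) S) =
      f3 - f1 - f2 + rscale (q ^+ 2) S.
    apply/funext => x; rewrite /f1 /f2 /f3 /rscale !fctE.
    rewrite (_ : (e + q) ^+ 2 - e ^+ 2 = 2 * e * q + q ^+ 2); last by ring.
    rewrite !rmorphD !rmorphM/= ?rmorphXn/=; ring.
  have : N (rscale q (F1 (rscale e h) h - G - rscale (2 * e) S)) <=
      N f3 + N f1 + N f2 + q ^+ 2 * N S.
    rewrite id1.
    apply: le_trans (hnormD (HsB (HsB H3 H1) H2) (Hs_scale (q ^+ 2) hS)) _.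
    rewrite (hnormZ _ hS) (ger0_norm (sqr_ge0 q)) lerD2r.
    apply: le_trans (hnormB (HsB H3 H1) H2) _.
    by rewrite lerD2r; exact: hnormB.
  rewrite hnormZ// gtr0_norm// b2 addr0.
  set L := N (_ - _ - _) => bL.
  have {}bL : q * L <= q * (C3 * (e + q + e) ^+ 2 + k * N h + q * N S).
    by rewrite expr2 in bL; lra.
  rewrite ler_pM2l// in bL; apply: le_trans bL _.
  have : C3 * (e + q + e) ^+ 2 <= 8 * C3 * e ^+ 2 + 2 * C3 * q.
    have : (e + q + e) ^+ 2 <= 8 * e ^+ 2 + 2 * q.
      have : 0 <= q * (1 - q) by rewrite mulr_ge0 ?subr_ge0 ?(ltW q0)//; lra.
      by have := sqr_ge0 (2 * e - q); rewrite !expr2; lra.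
    by move=> /(ler_wpM2l C30); lra.
  by rewrite /c in qc; nra.
have [d d0 hd] := dif2 _ D0 _ ltr01.
pose e2 := Num.min e1 (d / (N h + 1)).
have e20 : 0 < e2 by rewrite lt_min e10 divr_gt0.
suff : N S * 2 <= (`|C2| + 1) * N h ^+ 2 by have := sqr_ge0 (N h); nra.
apply: (@le_of_small _ _ (8 * C3 + 2) _ e20) => e ep ee.
have ee1 : e < e1 by rewrite (lt_le_trans ee)// ge_min lexx.
have eed : e * (N h + 1) < d.
  by rewrite -ltr_pdivlMr// (lt_le_trans ee)// ge_min lexx orbT.
have Dx := De _ (ltW ep) ee1.
have [[F1H _ _] _] := lin _ Dx; have [F1H0 _ _] := lin1.
have x0 : rscale e h - (fun=> 0) = rscale e h.
  by rewrite -scale0 scaleB subr0.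
have Heh : Hs realv s (rscale e h) by exact: Hs_scale.
have [F2H _ _] := F2l _ hh.
have [F2He _ _] := F2l _ Heh.
have eta0 : 0 < e ^+ 2 by rewrite exprn_gt0.
have b1 := der _ _ (ltW ep) ee1 eta0.
have b2 := der _ _ (lexx 0) e10 eta0.
rewrite scale0 expr0n mulr0 mulr0 add0r in b2.
have := hd _ Dx; rewrite x0 (Hs_norm_fine (Hs_weaken Heh)) hnormZ// (gtr0_norm ep).
rewrite lte_fin => /(_ _)/wrap[]; first by nra.
move=> /(_ _ hh).
have h1 : H (F1 (rscale e h) h) by exact/Hs_weaken/F1H.
have h2 : H (F1 (fun=> 0) h) by exact/Hs_weaken/F1H0.
have h3 : H (F2 (fun=> 0) (rscale e h) h) by exact/Hs_weaken/F2He.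
have h4 : H (F2 (fun=> 0) h h) by exact/Hs_weaken/F2H.
rewrite Hs_norm_fine; last exact: (HsB (HsB h1 h2) h3).
rewrite (Hs_norm_fine Hh) -!EFinM lee_fin mul1r => b3.
have b4 := bounded_linear_scale e (F2lin _ hh) hh.
have := F2b _ _ hh hh; rewrite !Hs_norm_fine// -!EFinM lee_fin => b5.
set f1 := (X in N X <= _) in b1; set f2 := (X in N X <= _) in b2.
set f3 := (X in N X <= _) in b3; set f4 := (X in N X = _) in b4.
have H1 : H f1 by apply: HsB; [exact: HsB|exact: Hs_scale].
have H2 : H f2 by apply: HsB; [exact: HsB|exact: Hs_scale].
have H3 : H f3 by exact: (HsB (HsB h1 h2) h3).
have H4 : H f4 by exact: (HsB h3 (Hs_scale e h4)).
have id1 : rscale (2 * e) S =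
    f3 + f4 - f1 + f2 + rscale e (F2 (fun=> 0) h h).
  apply/funext => x; rewrite /f1 /f2 /f3 /f4 /rscale !fctE.
  by rewrite !rmorphM !rmorph0/=; ring.
have : N (rscale (2 * e) S) <=
    N f3 + N f4 + N f1 + N f2 + e * N (F2 (fun=> 0) h h).
  rewrite id1.
  apply: le_trans (hnormD (HsD (HsB (HsD H3 H4) H1) H2) (Hs_scale e h4)) _.
  rewrite (hnormZ _ h4) (gtr0_norm ep) lerD2r.
  apply: le_trans (hnormD (HsB (HsD H3 H4) H1) H2) _; rewrite lerD2r.
  apply: le_trans (hnormB (HsD H3 H4) H1) _; rewrite lerD2r.
  exact: hnormD.
rewrite hnormZ// gtr0_norm ?mulr_gt0// b4 addr0 => bS.
have b6 : N (F2 (fun=> 0) h h) <= `|C2| * N h ^+ 2.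
  apply: le_trans b5 _; rewrite -mulrA -expr2 ler_wpM2r ?sqr_ge0//.
  exact: ler_norm.
have {}bS : e * (N S * 2) <=
    e * ((`|C2| + 1) * N h ^+ 2 + (8 * C3 + 2) * e).
  have := ler_wpM2l (ltW ep) b6; nra.
by rewrite ler_pM2l// in bS.
Qed.

End SecondOrder.

(** * The flow map on exponentially decaying data *)

Section FieldSobolev.
Context {R : realType}.
Notation mu1 := (@lebesgue_measure R).
Implicit Types (f : R -> R[i]) (U : R -> R -> R[i]) (s A t : R).

Lemma decay_bound_integrable s f A : cmeasurable f ->
  (forall xi, normc (f xi) <= A * decay xi) ->
  mu1.-integrable setT
    (EFin \o (fun xi => (sobolev_weight s xi * normc (f xi)) ^+ 2)).
Proof.
move=> mf fA; apply: (integrable_dominated _ _ (integrable_decay_energy s A)).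
- by [].
- exact: measurable_energy.
move=> xi _; rewrite ger0_norm ?sqr_ge0// lerXn2r ?nnegrE//.
- by rewrite mulr_ge0 ?sobolev_weight_ge0 ?normc_ge0.
- by rewrite mulr_ge0 ?sobolev_weight_ge0// (le_trans (normc_ge0 _) (fA xi)).
- by rewrite ler_wpM2l ?sobolev_weight_ge0.
Qed.

(** The factor [1] gives the integrand the shape of [integrable_decay_energy]. *)
Definition decay_norm s : R :=
  Num.sqrt (\int[mu1]_xi (sobolev_weight s xi * (1 * decay xi)) ^+ 2).

Lemma Hs_norm_decay_bound s f A : cmeasurable f -> 0 <= A ->
  (forall xi, normc (f xi) <= A * decay xi) ->
  (Hs_norm s f <= (decay_norm s * A)%:E)%E.
Proof.
move=> mf A0 fA; rewrite (Hs_norm_sqrt (decay_bound_integrable s mf fA)).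
rewrite lee_fin -[X in _ * X](ger0_norm A0) -sqrtr_sqr /decay_norm -sqrtrM; last first.
  by apply: Rintegral_ge0 => x _; exact: sqr_ge0.
apply: ler_wsqrtr; rewrite mulrC -RintegralZl//; last exact: integrable_decay_energy.
apply: le_Rintegral => //.
- exact: decay_bound_integrable fA.
- by apply: integrable_scale => //; exact: integrable_decay_energy.
move=> xi _; rewrite mul1r -exprMn mulrCA.
rewrite lerXn2r ?nnegrE//.
- by rewrite mulr_ge0 ?sobolev_weight_ge0 ?normc_ge0.
- by rewrite mulr_ge0 ?sobolev_weight_ge0// mulr_ge0// decay_ge0.
- by rewrite ler_wpM2l ?sobolev_weight_ge0.
Qed.

Lemma decaying_Hs realv s A U t : decaying A U -> Hs realv s (U t).
Proof.
move=> fU; have A0 := decaying_ge0 fU; have [bU cx _ hU] := fU.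
split; first exact: ccont_measurable.
  apply: le_lt_trans (Hs_norm_decay_bound s (ccont_measurable (cx t)) A0 (bU t)) _.
  exact: ltry.
by move=> _; apply: aeW => xi; rewrite hU.
Qed.

(** Pointwise continuity in time and a uniform bound that is integrable against
    every Sobolev weight. *)
Lemma decaying_continuous_Hs realv s T A U :
  decaying A U -> continuous_Hs realv s T U.
Proof.
move=> fU; split=> [t _|t tT e e0]; first exact: decaying_Hs fU.
have [_ cx ct _] := fU.
pose E t' xi := (sobolev_weight s xi * normc (U t' xi - U t xi)) ^+ 2.
have bd t' xi : normc (U t' xi - U t xi) <= (A + A) * decay xi.
  have [b _ _ _] := fU.
  by rewrite (le_trans (normcB _ _))// mulrDl lerD.
have md t' : cmeasurable (fun xi => U t' xi - U t xi).
  by apply: ccont_measurable; exact: ccontB.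
have cE : continuous (fun t' => \int[mu1]_(xi in setT) E t' xi).
  apply: (continuous_Rintegral measurableT _ _ (integrable_decay_energy s (A + A))).
  - by move=> t'; exact: measurable_energy (md t').
  - move=> xi _ t'; rewrite /E.
    apply: (@continuous_comp _ _ _
      (fun t' => sobolev_weight s xi * normc (U t' xi - U t xi))
      (fun y => y ^+ 2)); last exact: exprn_continuous.
    apply: cvgM; first exact: cvg_cst.
    apply: (continuous_normc (f := fun t' => U t' xi - U t xi)).
    by apply: ccontB => //; exact: ccont_cst.
  - move=> t' xi _; rewrite ger0_norm ?sqr_ge0// lerXn2r ?nnegrE//.
    + by rewrite mulr_ge0 ?sobolev_weight_ge0 ?normc_ge0.
    + by rewrite mulr_ge0 ?sobolev_weight_ge0// (le_trans (normc_ge0 _) (bd t' xi)).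
    + by rewrite ler_wpM2l ?sobolev_weight_ge0.
have E0 : \int[mu1]_(xi in setT) E t xi = 0.
  have -> : E t = (fun=> 0).
    apply/funext => xi; rewrite /E subrr ComplexField.Normc.normc0.
    by rewrite mulr0 expr0n.
  by rewrite Rintegral_cst// mul0r.
have e2 : 0 < e ^+ 2 by rewrite exprn_gt0.
have /cvgrPdist_lt/(_ _ e2) := cE t.
move=> /nbhs_ballP[d /= d0 hd]; exists d => // t' _ t't.
have := hd t'; rewrite /ball/= distrC => /(_ t't).
rewrite E0 sub0r normrN ger0_norm => [Elt|]; last first.
  by apply: Rintegral_ge0 => x _; exact: sqr_ge0.
rewrite (Hs_norm_sqrt (decay_bound_integrable s (md t') (bd t'))) lte_fin.
by rewrite -(ger0_norm (ltW e0)) -sqrtr_sqr ltr_sqrt.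
Qed.

End FieldSobolev.

Section FlowMap.
Context {R : realType}.
Notation mu1 := (@lebesgue_measure R).
Variables (mu T : R).
Hypotheses (mu0 : 0 < mu) (T0 : 0 <= T).
Implicit Types (h : R -> R[i]).

Lemma ae_imply (P Q : R -> Prop) : (forall x, P x -> Q x) ->
  {ae mu1, forall x, P x} -> {ae mu1, forall x, Q x}.
Proof.
move=> PQ [A [mA A0 subA]]; exists A; split => // x /= nQ.
by apply: subA => /= /PQ.
Qed.

Definition free_flow h t xi : R[i] := npBO_symbol mu (clamp T t) xi * h xi.

(** Real-valued data that generate decaying trajectories. *)
Definition profile b h :=
  [/\ forall xi, normc (h xi) <= b * decay xi, ccont h &
      forall xi, h (- xi) = conjc (h xi)].

Lemma decaying_free_flow b h : profile b h ->
  decaying (expR (mu * T) * b) (free_flow h).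
Proof.
move=> [bh ch hh]; split.
- move=> t xi; rewrite /free_flow ComplexField.Normc.normcM -mulrA.
  have /andP[t0 tT] := clamp_itv t T0.
  apply: ler_pM; rewrite ?normc_ge0//.
  apply: le_trans (symbol_le xi (ltW mu0) t0) _.
  by rewrite ler_expR ler_wpM2l// ltW.
- by move=> t; apply: ccontM => //; exact: ccont_symbol_xi.
- move=> xi; apply: ccontM; last exact: ccont_cst.
  apply: (@ccont_comp _ (fun t => npBO_symbol mu t xi) (clamp T)).
    exact: ccont_symbol_t.
  exact: continuous_clamp.
- by move=> t xi; rewrite /free_flow symbol_conj hh; exact/esym/conjcM.
Qed.

Lemma profile_Hs realv s b h : profile b h -> Hs realv s h.
Proof.
move=> [bh ch hh].
have b0 : 0 <= b.
  by have := le_trans (normc_ge0 _) (bh 0); rewrite decay0 mulr1.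
split; first exact: ccont_measurable.
  apply: le_lt_trans (Hs_norm_decay_bound s (ccont_measurable ch) b0 bh) _.
  exact: ltry.
by move=> _; apply: aeW => xi; rewrite hh.
Qed.

Lemma mild_duhamel_solution realv s a eps h U :
  mild (duhamel mu T) a (free_flow h) eps U ->
  duhamel_solution realv mu s T (rscale eps h) U.
Proof.
move=> [fU eU]; split=> [t _|t tT]; first exact: decaying_Hs fU.
apply: aeW => xi; split.
- by apply: aeW => tau _; exact: (decaying_product_defined fU fU).
- exact: (ccont_integrable_itv _ _ (ccont_duhamel_integrand mu fU fU _ _)).
- rewrite eU /free_flow /duhamel clamp_id// /rscale.
  by rewrite [in LHS]mulrCA.
Qed.

(** For small [e] the mild solution with datum [e h] belongs to the uniqueness
    class and is therefore the one selected by the flow; its expansion in [e] is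
    the one required by [C2_second_order]. *)
Lemma C2_bounds_second_iterate realv s D X Phi t :
  Hs_open realv s D -> D (fun=> 0) -> flow_map realv mu s T D X Phi ->
  0 <= t <= T -> C2_on realv s D (fun phi => Phi phi t) ->
  exists2 C : R, 0 <= C & forall b h, profile b h ->
    fine (Hs_norm s (duhamel mu T (free_flow h) (free_flow h) t)) <=
    C * fine (Hs_norm s h) ^+ 2.
Proof.
move=> oD D0 [inX sol uniq] tT C2.
have [C C0 hC] := C2_second_order oD D0 C2; exists C => // b h ph.
have fF := decaying_free_flow ph; set a := _ * b in fF.
set F := free_flow h in fF *; have a0 := decaying_ge0 fF.
pose K := duhamel_cst mu T.
have K0 : 0 <= K by exact: duhamel_cst_ge0.
pose e0 := (8 * K * a + 1)^-1.
have Ka0 : 0 <= 8 * K * a by apply: mulr_ge0 => //; exact: mulr_ge0.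
have k0 : 0 < 8 * K * a + 1 by rewrite ltr_wpDl.
have e00 : 0 < e0 by rewrite invr_gt0.
have small e : 0 <= e < e0 -> 8 * K * a * `|e| <= 1.
  move=> /andP[ep ee]; rewrite ger0_norm//.
  have : (8 * K * a + 1) * e <= 1.
    by rewrite mulrC -ler_pdivlMr// mul1r ltW.
  lra.
have fB A M U V : decaying A U -> decaying M V ->
    decaying (K * (A * M)) (duhamel mu T U V).
  by move=> fU fV; exact: decaying_duhamel.
have Bl A A' M U U' V
  (fU : decaying A U) (fU' : decaying A' U') (fV : decaying M V) :=
  duhamelDl mu T fU fU' fV.
have Br A A' M U U' V
  (fU : decaying A U) (fU' : decaying A' U') (fV : decaying M V) :=
  duhamelDr mu T fU fU' fV.
have Zl A M U V (fU : decaying A U) (fV : decaying M V) (r : R) t xi :=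
  duhamelZl mu T fU fV r t xi.
have Zr A M U V (fU : decaying A U) (fV : decaying M V) (r : R) t xi :=
  duhamelZr mu T fU fV r t xi.
have flowE e U : D (rscale e h) -> mild (duhamel mu T) a F e U ->
    {ae mu1, forall xi, U t xi = Phi (rscale e h) t xi}.
  move=> De mU; apply: uniq => //; last exact: mild_duhamel_solution mU.
  apply: inX De _ _; first exact: mild_duhamel_solution mU.
  by move=> sigma; apply: decaying_continuous_Hs; exact: mU.1.
have FS := decaying_Hs false s t (fB _ _ _ _ fF fF).
have GS := decaying_Hs false s t fF.
apply: (hC h (F t) (duhamel mu T F F t) (decay_norm s * (24 * K ^+ 2 * a ^+ 3)) e0)
  => //.
- exact: profile_Hs ph.
- apply: mulr_ge0; first exact: sqrtr_ge0.
  by apply: mulr_ge0; [apply: mulr_ge0 => //|]; exact: exprn_ge0.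
move=> e e' eI eI' De De'.
have [U mU] := mild_exists K0 fB Bl Br fF (small _ eI).
have [U' mU'] := mild_exists K0 fB Bl Br fF (small _ eI').
have fR := mild_expansion K0 fB Bl Br Zl Zr fF (small _ eI) (small _ eI') mU mU'.
have hP := Hs_weaken ((sol _ De).2.1 _ tT).
have hP' := Hs_weaken ((sol _ De').2.1 _ tT).
have [fU _] := mU; have [fU' _] := mU'.
have hU := decaying_Hs false s t fU; have hU' := decaying_Hs false s t fU'.
have hG := Hs_scale (e - e') GS; have hS := Hs_scale (e ^+ 2 - e' ^+ 2) FS.
set G := rscale (e - e') _ in hG *; set S := rscale (e ^+ 2 - e' ^+ 2) _ in hS *.
have -> : Hs_norm s (Phi (rscale e h) t - Phi (rscale e' h) t - G - S) =
    Hs_norm s (U t - U' t - G - S).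
  transitivity (Hs_norm s (U t - Phi (rscale e' h) t - G - S)).
    apply: ae_eq_Hs_norm; [by case: (HsB (HsB (HsB hP hP') hG) hS)
      |by case: (HsB (HsB (HsB hU hP') hG) hS)|].
    by apply: ae_imply (flowE _ _ De mU) => x e1; rewrite !fctE -e1.
  apply: ae_eq_Hs_norm; [by case: (HsB (HsB (HsB hU hP') hG) hS)
    |by case: (HsB (HsB (HsB hU hU') hG) hS)|].
  by apply: ae_imply (flowE _ _ De' mU') => x e1; rewrite !fctE -e1.
rewrite -lee_fin fineK; last first.
  have [_ n _] := HsB (HsB (HsB hU hU') hG) hS.
  by rewrite ge0_fin_numE// Hs_norm_ge0.
have [bR cR _ _] := fR; have R0 := decaying_ge0 fR.
apply: le_trans (Hs_norm_decay_bound s (ccont_measurable (cR t)) R0 (bR t)) _.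
have /andP[ep _] := eI; have /andP[ep' _] := eI'.
by rewrite lee_fin (ger0_norm ep) (ger0_norm ep') !mulrA.
Qed.

End FlowMap.

(** * A wave packet *)

Section Tent.
Context {R : realType}.
Notation mu1 := (@lebesgue_measure R).
Implicit Types (M s xi eta : R).

Lemma cos_ge_linear (x : R) : 1 - `|x| <= cos x.
Proof.
suff h (y : R) : 0 <= y -> 1 - y <= cos y.
  have [x0|x0] := leP 0 x; first by rewrite ger0_norm// h.
  by rewrite ltr0_norm// -cosN h// oppr_ge0 ltW.
move=> y0; have [c _] := @MVT_segment R cos (fun z => - sin z) 0 y y0
  (fun z _ => is_derive_cos z) (continuous_subspaceT (@continuous_cos R)).
by rewrite cos0 subr0 => e; have := sin_le1 c; nra.
Qed.

(** Two tents of width 2 centred at [M] and [- M].  The function is even, so that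
    the datum is real-valued. *)
Definition tent M xi : R := Num.max 0 (1 - `| `|xi| - M|).

Lemma tent_ge0 M xi : 0 <= tent M xi.
Proof. by rewrite le_max lexx. Qed.

Lemma tent_le1 M xi : tent M xi <= 1.
Proof. by rewrite ge_max ler01 gerBl normr_ge0. Qed.

Lemma tent_ge M xi : 1 - `| `|xi| - M| <= tent M xi.
Proof. by rewrite le_max lexx orbT. Qed.

Lemma tent_support M xi : tent M xi != 0 -> `| `|xi| - M| <= 1.
Proof.
rewrite /tent; case: (leP (1 - `| `|xi| - M|) 0); first by rewrite eqxx.
by move=> + _; rewrite subr_gt0 => /ltW.
Qed.

Lemma continuous_tent M : continuous (tent M).
Proof.
have -> : tent M = fun xi =>
    (1 - `| `|xi| - M| + `|1 - `| `|xi| - M| |) / 2.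
  apply/funext => xi; rewrite /tent; move: (1 - _) => u.
  by case: (leP u 0) => u0; [rewrite ler0_norm|rewrite gtr0_norm]; lra.
have c1 : continuous (fun xi => 1 - `| `|xi| - M|).
  move=> xi; apply: cvgB; first exact: cvg_cst.
  apply: cvg_norm; apply: cvgB; last exact: cvg_cst.
  exact: norm_continuous.
move=> xi; apply: cvgM; last exact: cvg_cst.
by apply: cvgD; [exact: c1|apply: cvg_norm; exact: c1].
Qed.

Definition tent_datum M xi : R[i] := (tent M xi)%:C.

Lemma normc_tent_datum M xi : normc (tent_datum M xi) = tent M xi.
Proof. by rewrite normc_real ger0_norm// tent_ge0. Qed.

Lemma profile_tent M : 0 <= M -> exists b, profile b (tent_datum M).
Proof.
move=> M0; have M10 : 0 <= M + 1 by lra.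
exists (expR (M + 1) * (1 + (M + 1) ^+ 3)); split.
- move=> xi; rewrite normc_tent_datum.
  have [->|/tent_support] := eqVneq (tent M xi) 0.
    apply: mulr_ge0; last exact: decay_ge0.
    apply: mulr_ge0; first exact: expR_ge0.
    by rewrite addr_ge0 ?exprn_ge0.
  rewrite ler_norml => /andP[_ xiM]; apply: (le_trans (tent_le1 _ _)).
  have {}xiM : `|xi| <= M + 1 by lra.
  have d0 : 0 < 1 + `|xi| ^+ 3 by rewrite ltr_wpDr// exprn_ge0.
  rewrite /decay mulrA ler_pdivlMr// mul1r.
  have -> : expR (M + 1) * (1 + (M + 1) ^+ 3) * expR (- `|xi|) =
    expR (M + 1 - `|xi|) * (1 + (M + 1) ^+ 3) by rewrite (expRD (M + 1)); ring.
  apply: (@le_trans _ _ (1 + (M + 1) ^+ 3)).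
    by rewrite lerD2l lerXn2r ?nnegrE.
  apply: ler_peMl; last by rewrite -[leLHS]expR0 ler_expR subr_ge0.
  by rewrite addr_ge0 ?exprn_ge0.
- by apply: ccont_real; exact: continuous_tent.
- by move=> xi; rewrite /tent_datum conjc_rC /tent normrN.
Qed.

Lemma Rintegral_indic_itv (a b : R) : a <= b ->
  \int[mu1]_x (\1_`[a, b]%classic x : R) = b - a.
Proof.
move=> ab; rewrite -[RHS]mul1r -(Rintegral_cst_itv 1 ab).
by rewrite [RHS]Rintegral_mkcond; apply: eq_Rintegral => x _;
  rewrite patchE indicE; case: ifP.
Qed.

(** On the support of the tents [|xi| >= M / 2], and the support has measure 4. *)
Lemma Hs_norm_tent s M : s <= 0 -> 2 <= M ->
  fine (Hs_norm s (tent_datum M)) ^+ 2 <= 4 * (M ^+ 2 / 4) `^ s.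
Proof.
move=> s0 M2; have M0 : 0 <= M by lra.
have [b [bb cb _]] := profile_tent M0.
have ie := decay_bound_integrable s (ccont_measurable cb) bb.
have fE (x : R) : fine x%:E = x by [].
rewrite (Hs_norm_sqrt ie) fE sqr_sqrtr; last first.
  by apply: Rintegral_ge0 => x _; exact: sqr_ge0.
set k := _ `^ s.
pose A : set R := `[M - 1, M + 1]%classic.
pose B : set R := `[- M - 1, 1 - M]%classic.
have iA : mu1.-integrable setT (EFin \o (\1_A : R -> R)).
  exact: integrable_indic_itv.
have iB : mu1.-integrable setT (EFin \o (\1_B : R -> R)).
  exact: integrable_indic_itv.
have iAB : mu1.-integrable setT (EFin \o (fun x => \1_A x + \1_B x : R)).
  have := @integrableD _ _ _ mu1 setT measurableT _ _ iA iB.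
  by apply: eq_integrable.
apply: (@le_trans _ _ (\int[mu1]_x (k * (\1_A x + \1_B x)))).
  apply: le_Rintegral => //; first exact: integrable_scale.
  move=> xi _; rewrite exprMn normc_tent_datum sqr_sobolev_weight.
  have k0 : 0 <= k by exact: powR_ge0.
  have [->|/tent_support hM] := eqVneq (tent M xi) 0.
    by rewrite expr0n mulr0 mulr_ge0// addr_ge0// indicE ler0n.
  have AB : 1 <= \1_A xi + \1_B xi :> R.
    move: hM; rewrite ler_norml => /andP[h1 h2].
    rewrite !indicE; have [x0|x0] := leP 0 xi.
      rewrite (_ : xi \in A) ?lerDl//; rewrite ger0_norm// in h1 h2.
      by rewrite inE /A/= in_itv/=; apply/andP; split; lra.
    rewrite (_ : xi \in B) ?lerDr//; rewrite ltr0_norm// in h1 h2.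
    by rewrite inE /B/= in_itv/=; apply/andP; split; lra.
  apply: (@le_trans _ _ (k * 1)); last by rewrite ler_wpM2l.
  apply: ler_pM; rewrite ?powR_ge0 ?sqr_ge0//; last first.
    by rewrite expr_le1// ?tent_ge0 ?tent_le1.
  have x2 : M ^+ 2 / 4 <= 1 + xi ^+ 2.
    move: hM; rewrite ler_norml => /andP[h1 _].
    rewrite -(real_normK (num_real xi)).
    have : M / 2 <= `|xi| by lra.
    nra.
  have M4 : 0 < M ^+ 2 / 4 by rewrite divr_gt0// exprn_gt0//; lra.
  have x0 := lt_le_trans M4 x2.
  rewrite /k -(opprK s) 2!(powRN _ (- s)) lef_pV2 ?posrE ?powR_gt0//.
  apply: ge0_ler_powR => //; first by rewrite oppr_ge0.
    by rewrite nnegrE ltW.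
  by rewrite nnegrE ltW.
rewrite RintegralZl// RintegralD// !Rintegral_indic_itv; [|lra|lra].
by rewrite le_eqVlt; apply/orP; left; apply/eqP; ring.
Qed.

End Tent.

(** * Interactions of high frequencies *)

Section LowFrequency.
Context {R : realType}.
Notation mu1 := (@lebesgue_measure R).
Implicit Types (mu T M A t tau xi eta : R).

Lemma integrable_convolution A (U : R -> R -> R[i]) t xi : decaying A U ->
  cintegrable setT (fun eta => U t (xi - eta) * U t eta).
Proof.
move=> fU; have A0 := decaying_ge0 fU; have [bU cU _ _] := fU.
apply: (cintegrable_dominated measurableT _
  (integrable_product_majorant (A * A))).
  by apply/ccont_measurable/ccontM => //; exact: ccont_reflect.
move=> eta _; rewrite ComplexField.Normc.normcM -mulrA.
have le1 : normc (U t (xi - eta)) <= A.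
  by apply: le_trans (bU _ _) _; rewrite ler_piMr// decay_le1.
apply: ler_pM; rewrite ?normc_ge0//.
by apply: le_trans (bU _ _) _; rewrite ler_wpM2l// decay_le_lorentz.
Qed.

(** The product [u u_x] is half of the derivative of [u ^ 2]; on the Fourier side,
    one averages the convolution with its image under [eta |-> xi - eta].
    Without this symmetrization the contributions of [eta] near [M] and near
    [- M], each of order [M], would hide their cancellation. *)
Lemma product_hat_dx A (U : R -> R -> R[i]) t xi : decaying A U ->
  product_hat (U t) (dx (U t)) xi =
  ((2 * pi)^-1)%:C * (0 +i* (xi / 2)) *
    cintegral setT (fun eta => U t (xi - eta) * U t eta).
Proof.
move=> fU; rewrite /product_hat -mulrA; congr (_ * _).
set I := LHS; set J := cintegral _ _.
have def1 : cintegrable setT (fun eta => U t (xi - eta) * dx (U t) eta).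
  exact: (decaying_product_defined fU fU).
have IE : I = cintegral setT (fun eta => U t eta * dx (U t) (xi - eta)).
  rewrite /I -(cintegral_reflect xi (cmeasurable_product_integrand fU fU t xi)).
  apply: eq_cintegral => eta _; congr (U t _ * _); ring.
have def2 : cintegrable setT (fun eta => U t eta * dx (U t) (xi - eta)).
  have -> : (fun eta => U t eta * dx (U t) (xi - eta)) = (fun eta =>
      (0 +i* xi) * (U t (xi - eta) * U t eta) +
      (- 1) * (U t (xi - eta) * dx (U t) eta)).
    apply/funext => eta; rewrite /dx.
    have -> : 0 +i* (xi - eta) = (0 +i* xi) - (0 +i* eta) :> R[i].
      by simpc.
    by ring.
  apply: cintegrableD => //; apply: cintegrableZ => //.
  exact: integrable_convolution fU.
have : I + I = (0 +i* xi) * J.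
  rewrite {2}IE /I -cintegralD//.
  rewrite -cintegralZ//; last exact: (integrable_convolution t xi fU).
  apply: eq_cintegral => eta _; rewrite /dx.
  have -> : 0 +i* (xi - eta) = (0 +i* xi) - (0 +i* eta) :> R[i] by simpc.
  by ring.
have -> : 0 +i* xi = (0 +i* (xi / 2)) * 2 :> R[i].
  by rewrite mulr_natr mulr2n; simpc; congr (_ +i* _); lra.
move=> h; apply: (@mulIf _ (2 : R[i])); first by rewrite pnatr_eq0.
by rewrite mulr_natr mulr2n h; ring.
Qed.

(** Since [cos x >= 1 - |x|], the oscillation costs at most
    [Th tau exp (- am tau)], and [tau exp (- am tau / 2) <= 2 / am].  The lower bound
    depends on the frequencies only through the extreme values of the rate [a]
    and of the phase [th]. *)
Lemma oscillating_lower_bound (am a ap Th th tau : R) : 0 < am -> am <= a ->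
  a <= ap -> `|th| <= Th -> 0 <= tau ->
  expR (- ap * tau) - 2 * Th / am * expR (- (am / 2) * tau) <=
  expR (- a * tau) * cos (th * tau).
Proof.
move=> am0 ama aap thT tau0.
have Th0 : 0 <= Th := le_trans (normr_ge0 _) thT.
have c1 : 1 - Th * tau <= cos (th * tau).
  apply: le_trans (cos_ge_linear _); rewrite lerD2l lerN2 normrM (ger0_norm tau0).
  exact: ler_wpM2r.
apply: le_trans (ler_wpM2l (expR_ge0 _) c1).
rewrite mulrBr mulr1; apply: lerB.
  by rewrite ler_expR ler_wpM2r// lerN2.
have e1 : expR (- a * tau) <= expR (- am * tau).
  by rewrite ler_expR ler_wpM2r// lerN2.
apply: (@le_trans _ _ (expR (- am * tau) * (Th * tau))).
  by rewrite ler_wpM2r// mulr_ge0.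
have -> : - am * tau = - (am / 2) * tau + - (am / 2) * tau by field.
rewrite expRD; set E := expR _.
have hE : tau * E <= 2 / am.
  have := expR_ge1Dx (am / 2 * tau).
  have EE : E * expR (am / 2 * tau) = 1.
    by rewrite /E -expRD mulNr addNr expR0.
  have E0 : 0 <= E by exact: expR_ge0.
  move=> /(ler_wpM2l E0); rewrite EE => h.
  rewrite ler_pdivlMr//; nra.
have : Th * E * (tau * E) <= Th * E * (2 / am).
  by rewrite ler_wpM2l// mulr_ge0 ?expR_ge0.
by apply: le_trans; [rewrite le_eqVlt; apply/orP; left; apply/eqP; ring|] || lra.
Qed.

Lemma integral_expN (a t : R) : 0 < a -> 0 <= t ->
  \int[mu1]_(tau in `[0, t]) expR (- a * tau) = (1 - expR (- a * t)) / a.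
Proof.
move=> a0 t0; have := integral_exp (- a) 0 t0.
rewrite expR0 RintegralZl//; last first.
  apply: (continuous_integrable_itv (f := fun tau => expR (- a * tau + 0))).
  apply: (continuous_expR_comp (h := fun tau => - a * tau + 0)) => y.
  apply: cvgD; last exact: cvg_cst.
  by apply: cvgM; [exact: cvg_cst|exact: cvg_id].
under eq_Rintegral do rewrite addr0.
rewrite addr0 => h; apply: (@mulfI _ (- a)); first by rewrite oppr_eq0 gt_eqF.
by rewrite h; field; rewrite gt_eqF.
Qed.

(** With [r] and [q] the moduli of two frequencies close to [M] and [x] that of their
    sum: the damping rate is of order [M ^ 3], the phase of order [M ^ 2]. *)
Lemma high_high_dissipation M (x r q : R) : 4 <= M -> 0 <= x <= 1 ->
  `|r - M| <= 1 -> `|q - M| <= 1 ->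
  [/\ M ^+ 3 / 2 <= (r ^+ 3 - r) + (q ^+ 3 - q) + (x - x ^+ 3),
      (r ^+ 3 - r) + (q ^+ 3 - q) + (x - x ^+ 3) <= 5 * M ^+ 3 &
      r ^+ 2 + q ^+ 2 + x ^+ 2 <= 4 * M ^+ 2].
Proof.
move=> M4 /andP[x0 x1]; rewrite !ler_norml => /andP[r1 r2] /andP[q1 q2].
have cub (z : R) : M - 1 <= z -> z <= M + 1 ->
    [/\ 27 / 64 * M ^+ 3 <= z ^+ 3, z ^+ 3 <= 125 / 64 * M ^+ 3 & z <= M ^+ 3 / 12].
  move=> z1 z2; split.
  - have h : 3 / 4 * M <= z by lra.
    have -> : 27 / 64 * M ^+ 3 = (3 / 4 * M) ^+ 3 by field.
    by rewrite lerXn2r ?nnegrE//; lra.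
  - have -> : 125 / 64 * M ^+ 3 = (5 / 4 * M) ^+ 3 by field.
    by rewrite lerXn2r ?nnegrE//; lra.
  - have : 16 * M <= M ^+ 3.
      by rewrite exprSr ler_wpM2r//; [lra|rewrite expr2; nra].
    by lra.
have [r3 r4 r5] := cub r ltac:(lra) ltac:(lra).
have [q3 q4 q5] := cub q ltac:(lra) ltac:(lra).
have x3 : 0 <= x ^+ 3 by rewrite exprn_ge0.
have x31 : x ^+ 3 <= x by rewrite -[leRHS]expr1 ler_wiXn2l.
have M3 : 64 <= M ^+ 3.
  have -> : 64 = 4 ^+ 3 :> R by ring.
  by rewrite lerXn2r ?nnegrE//; lra.
split; [lra|lra|].
have sq (z : R) : M - 1 <= z -> z <= M + 1 -> z ^+ 2 <= 25 / 16 * M ^+ 2.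
  move=> z1 z2; have -> : 25 / 16 * M ^+ 2 = (5 / 4 * M) ^+ 2 by field.
  by rewrite lerXn2r ?nnegrE//; lra.
have := sq r ltac:(lra) ltac:(lra); have := sq q ltac:(lra) ltac:(lra).
have : x ^+ 2 <= 1 by rewrite expr_le1.
have : 16 <= M ^+ 2 by nra.
lra.
Qed.

End LowFrequency.

(** * The lower bound and ill-posedness *)

Section LowerBound.
Context {R : realType}.
Notation mu1 := (@lebesgue_measure R).
Variables (mu T t : R).
Hypotheses (mu0 : 0 < mu) (t0 : 0 < t) (tT : t <= T).
Implicit Types (M tau xi eta : R).

Let T0 : 0 <= T. Proof. exact: le_trans (ltW t0) tT. Qed.

(** The integrand of the second iterate, once the multiplier at time [t] has been
    factored out. *)
Lemma symbol_triple tau xi al be (b b' : R) :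
  complex.Re (npBO_symbol mu (- tau) xi *
    ((npBO_symbol mu tau al * b%:C) * (npBO_symbol mu tau be * b'%:C))) =
  expR (- (mu * ((`|al| ^+ 3 - `|al|) + (`|be| ^+ 3 - `|be|) +
                 (`|xi| - `|xi| ^+ 3))) * tau) *
  cos ((al * `|al| + be * `|be| - xi * `|xi|) * tau) * (b * b').
Proof.
pose cis (x : R) : R[i] := cos x +i* sin x.
have cisD x y : cis x * cis y = cis (x + y).
  by rewrite /cis cosD sinD; simpc; congr (_ +i* _); ring.
have -> : npBO_symbol mu (- tau) xi *
    ((npBO_symbol mu tau al * b%:C) * (npBO_symbol mu tau be * b'%:C)) =
  (expR (mu * (`|xi| - `|xi| ^+ 3) * - tau) * expR (mu * (`|al| - `|al| ^+ 3) * tau) *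
   expR (mu * (`|be| - `|be| ^+ 3) * tau) * (b * b'))%:C *
  (cis (xi * `|xi| * - tau) * cis (al * `|al| * tau) * cis (be * `|be| * tau)).
  rewrite /npBO_symbol -!/(cis _) !rmorphM/=.
  move: (cis (xi * _ * _)) (cis (al * _ * _)) (cis (be * _ * _)) => z1 z2 z3.
  move: (expR (_ * - tau)) (expR (mu * (`|al| - _) * _)) => e1 e2.
  move: (expR _) => e3.
  by ring.
rewrite !cisD -!expRD ReMc /= mul0r subr0.
set x := expR _; set y := cos _.
rewrite (_ : expR _ = x); last by congr expR; ring.
rewrite (_ : cos _ = y); last by congr cos; ring.
by ring.
Qed.

(** Beyond this frequency the oscillation takes away at most half of the main term
    ([20 * 64 / mu]), and the time [t] is longer than the damping time
    ([1 / (mu t)]). *)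
Definition threshold : R := 4 + 20 * 64 / mu + 1 / (mu * t).

Lemma threshold_ge4 : 4 <= threshold.
Proof.
have h1 : 0 < 20 * 64 / mu by rewrite divr_gt0 ?mulr_gt0.
have h2 : 0 < 1 / (mu * t) by rewrite divr_gt0// mulr_gt0.
by rewrite /threshold; lra.
Qed.

Definition interaction_cst : R := (2 * pi)^-1 / 8 * (8^-1 * (20 * mu)^-1).

(* The lower bound of [oscillating_lower_bound] for the rates and the phase given by
   [high_high_dissipation]. *)
Let damping M tau : R := expR (- (5 * mu * M ^+ 3) * tau) -
  2 * (4 * M ^+ 2) / (mu * M ^+ 3 / 2) * expR (- (mu * M ^+ 3 / 2 / 2) * tau).

Lemma integral_damping M : threshold <= M ->
  (20 * mu * M ^+ 3)^-1 <= \int[mu1]_(tau in `[0, t]) damping M tau.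
Proof.
move=> hM.
have mt0 : 0 < mu * t by rewrite mulr_gt0.
have h1 : 0 < 20 * 64 / mu by rewrite divr_gt0 ?mulr_gt0.
have h2 : 0 < 1 / (mu * t) by rewrite divr_gt0.
have M4 : 4 <= M := le_trans threshold_ge4 hM.
have Mmu : 20 * 64 <= mu * M.
  have : 20 * 64 / mu <= M by move: hM; rewrite /threshold; lra.
  by rewrite ler_pdivrMr// (mulrC M).
have Mt : 1 <= mu * t * M.
  have : 1 / (mu * t) <= M by move: hM; rewrite /threshold; lra.
  by rewrite ler_pdivrMr// (mulrC M).
have M0 : 0 < M by lra.
have M30 : 0 < M ^+ 3 by rewrite exprn_gt0.
have a0 : 0 < 5 * mu * M ^+ 3 by rewrite !mulr_gt0.
have c0 : 0 < mu * M ^+ 3 / 2 / 2 by rewrite !divr_gt0 ?mulr_gt0.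
have ie (a : R) : mu1.-integrable `[0, t] (EFin \o (fun tau => expR (- a * tau))).
  apply: continuous_integrable_itv; apply: continuous_expR_comp => y.
  by apply: cvgM; [exact: cvg_cst|exact: cvg_id].
rewrite RintegralB//; last first.
  by apply: integrable_scale => //; exact: ie.
rewrite RintegralZl// (integral_expN a0 (ltW t0)) (integral_expN c0 (ltW t0)).
set E1 := expR _; set E2 := expR _.
have E1le : E1 <= 1 / 2.
  have at1 : 1 <= 5 * mu * M ^+ 3 * t.
    have : M <= M ^+ 3 by rewrite -[leLHS]expr1 ler_weXn2l//; lra.
    move=> /(ler_wpM2l (ltW mt0)); nra.
  have /le_trans := expR_ge1Dx (5 * mu * M ^+ 3 * t).
  have e2 : 2 <= 1 + 5 * mu * M ^+ 3 * t by lra.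
  have := le_trans e2 (expR_ge1Dx _).
  have E1E : E1 * expR (5 * mu * M ^+ 3 * t) = 1.
    by rewrite /E1 -expRD mulNr addNr expR0.
  have : 0 <= E1 by exact: expR_ge0.
  nra.
have E20 : 0 <= E2 by exact: expR_ge0.
have b1 : (10 * mu * M ^+ 3)^-1 <= (1 - E1) / (5 * mu * M ^+ 3).
  have -> : (10 * mu * M ^+ 3)^-1 = (1 / 2) / (5 * mu * M ^+ 3).
    by field; rewrite !gt_eqF.
  by rewrite ler_wpM2r ?invr_ge0 ?(ltW a0)//; lra.
have b2 : (1 - E2) / (mu * M ^+ 3 / 2 / 2) <= 4 / (mu * M ^+ 3).
  have -> : 4 / (mu * M ^+ 3) = 1 / (mu * M ^+ 3 / 2 / 2).
    by field; rewrite !gt_eqF.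
  by rewrite ler_wpM2r ?invr_ge0 ?(ltW c0)//; lra.
have k0 : 0 <= 2 * (4 * M ^+ 2) / (mu * M ^+ 3 / 2).
  by rewrite divr_ge0 ?mulr_ge0 ?sqr_ge0 ?ltW.
have b3 := ler_wpM2l k0 b2.
have b4 : 2 * (4 * M ^+ 2) / (mu * M ^+ 3 / 2) * (4 / (mu * M ^+ 3)) <=
    (20 * mu * M ^+ 3)^-1.
  have -> : 2 * (4 * M ^+ 2) / (mu * M ^+ 3 / 2) * (4 / (mu * M ^+ 3)) =
      ((20 * 64) / (mu * M)) * (20 * mu * M ^+ 3)^-1.
    by field; rewrite !gt_eqF.
  apply: ler_piMl; first by rewrite invr_ge0 ltW// !mulr_gt0.
  by rewrite ler_pdivrMr ?mulr_gt0// mul1r.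
have -> : (20 * mu * M ^+ 3)^-1 = (10 * mu * M ^+ 3)^-1 - (20 * mu * M ^+ 3)^-1.
  by field; rewrite !gt_eqF.
exact: lerB b1 (le_trans b3 b4).
Qed.

(** If [xi] is between [1 / 4] and [1 / 2] then both tents are at least [1 / 2] for
    [eta] in [[M, M + 1 / 2]]. *)
Lemma tent_overlap M xi : 4 <= M -> 1 / 4 <= xi <= 1 / 2 ->
  mu1.-integrable setT
    (EFin \o (fun eta => tent M (xi - eta) * tent M eta)) /\
  8^-1 <= \int[mu1]_eta (tent M (xi - eta) * tent M eta).
Proof.
move=> M4 /andP[x1 x2].
have [b [bb _ _]] := @profile_tent R M ltac:(lra).
have b0 : 0 <= b.
  by have := le_trans (normc_ge0 _) (bb 0); rewrite decay0 mulr1.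
have ib : mu1.-integrable setT
    (EFin \o (fun eta => tent M (xi - eta) * tent M eta)).
  apply: (@integrable_dominated _ _ (fun eta => b * lorentz eta)) => //.
  - apply: continuous_measurable_fun => y; apply: cvgM.
      apply: (@continuous_comp _ _ _ (fun y => xi - y) (tent M)).
        by apply: cvgB; [exact: cvg_cst|exact: cvg_id].
      exact: continuous_tent.
    exact: continuous_tent.
  - by apply: integrable_scale => //; exact: integrable_lorentz.
  move=> eta _; rewrite ger0_norm ?mulr_ge0 ?tent_ge0//.
  apply: (@le_trans _ _ (1 * tent M eta)).
    by rewrite ler_wpM2r ?tent_ge0 ?tent_le1.
  rewrite mul1r; have := bb eta; rewrite normc_tent_datum => /le_trans; apply.
  by rewrite ler_wpM2l// decay_le_lorentz.
split => //.
pose A : set R := `[M, M + 1 / 2]%classic.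
have iM : mu1.-integrable setT (EFin \o (\1_A : R -> R)).
  exact: integrable_indic_itv.
have -> : 8^-1 = \int[mu1]_eta (4^-1 * (\1_A eta : R)).
  by rewrite RintegralZl// /A Rintegral_indic_itv; lra.
apply: le_Rintegral => //; first exact: integrable_scale.
move=> eta _; rewrite indicE.
case: (boolP (eta \in _)) => [|_]; last first.
  by rewrite mulr0 mulr_ge0 ?tent_ge0.
rewrite inE /A/= in_itv/= => /andP[e1 e2]; rewrite mulr1.
have h1 : 1 / 2 <= tent M eta.
  apply: le_trans (tent_ge _ _); rewrite (ger0_norm (_ : 0 <= eta)); last by lra.
  by rewrite ger0_norm; lra.
have h2 : 1 / 2 <= tent M (xi - eta).
  apply: le_trans (tent_ge _ _); rewrite (ler0_norm (_ : xi - eta <= 0)); last by lra.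
  have : `|- (xi - eta) - M| <= 1 / 2 by rewrite ler_norml; apply/andP; split; lra.
  lra.
nra.
Qed.

(** The second iterate at the frequency [xi] is a constant times the multiplier
    [m t], of modulus at least 1, times the time integral of [W tau].  The modulus
    of that integral is bounded below by its real part, hence by the integral of
    [damping] weighted with the overlap of the tents. *)
Lemma low_frequency_lower_bound M xi : threshold <= M -> 1 / 4 <= xi <= 1 / 2 ->
  interaction_cst / M ^+ 3 <=
  normc (duhamel mu T (free_flow mu T (tent_datum M))
    (free_flow mu T (tent_datum M)) t xi).
Proof.
move=> hM xi12; have /andP[x1 x2] := xi12.
have M4 : 4 <= M := le_trans threshold_ge4 hM.
have M0 : 0 < M by lra.
have [b pb] := @profile_tent R M (ltW M0).
set F := free_flow mu T (tent_datum M).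
have fF : decaying (expR (mu * T) * b) F by exact: decaying_free_flow.
pose c : R[i] := ((2 * pi)^-1)%:C * (0 +i* (xi / 2)).
pose W tau := npBO_symbol mu (- tau) xi *
  cintegral setT (fun eta => F tau (xi - eta) * F tau eta).
have pi2 : 0 < (2 * pi)^-1 :> R by rewrite invr_gt0 mulr_gt0// pi_gt0.
have nc : normc c = (2 * pi)^-1 * (xi / 2).
  rewrite /c ComplexField.Normc.normcM normc_real gtr0_norm//.
  by rewrite /= expr0n add0r sqrtr_sqr ger0_norm//; lra.
have c0 : c != 0.
  apply/eqP => c0; have : normc c = 0 by rewrite c0 ComplexField.Normc.normc0.
  by rewrite nc => /eqP; rewrite gt_eqF// mulr_gt0//; lra.
have cW tau : c * W tau =
    npBO_symbol mu (- tau) xi * product_hat (F tau) (dx (F tau)) xi.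
  by rewrite (product_hat_dx tau xi fF) /W -/c mulrCA.
(* [W] is the integrand of the Duhamel operator at time [0], up to [c]. *)
have contW : ccont W.
  have -> : W = (fun tau => c^-1 * (npBO_symbol mu (0 - tau) xi *
      product_hat (F tau) (dx (F tau)) xi)).
    by apply/funext => tau; rewrite sub0r -cW mulKf.
  apply: ccontM; first exact: ccont_cst.
  exact: (ccont_duhamel_integrand mu fF fF).
have iW := ccont_integrable_itv 0 t contW.
have tI : 0 <= t <= T by rewrite ltW.
have -> : duhamel mu T F F t xi =
    - (npBO_symbol mu t xi * c * cintegral `[0, t] W).
  rewrite -(cintegralZ (npBO_symbol mu t xi * c) (measurable_itv _) iW).
  transitivity (- cintegral `[0, t] (fun tau =>
    npBO_symbol mu (t - tau) xi * product_hat (F tau) (dx (F tau)) xi)).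
    exact: duhamelE.
  apply: (congr1 (fun z : R[i] => - z)).
  by apply: eq_cintegral => tau _; rewrite symbolD -[RHS]mulrA cW mulrA.
rewrite normcN 2!ComplexField.Normc.normcM nc.
have [ib hb] := tent_overlap M4 xi12.
set G := \int[mu1]_eta _ in hb.
have M30 : 0 < M ^+ 3 by rewrite exprn_gt0.
have am0 : 0 < mu * M ^+ 3 / 2 by rewrite divr_gt0// mulr_gt0.
have ReW tau : `[0, t]%classic tau -> G * damping M tau <= complex.Re (W tau).
  move=> itau.
  have /andP[tau0 taut] : 0 <= tau <= t by move: itau; rewrite /= in_itv.
  have cl : clamp T tau = tau by rewrite clamp_id// tau0 (le_trans taut).
  have iFF := integrable_convolution tau xi fF.
  have -> : W tau = cintegral setT (fun eta =>
      npBO_symbol mu (- tau) xi * (F tau (xi - eta) * F tau eta)).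
    by rewrite cintegralZ.
  rewrite -[complex.Re _]/(\int[mu1]_eta complex.Re
    (npBO_symbol mu (- tau) xi * (F tau (xi - eta) * F tau eta))).
  rewrite mulrC -RintegralZl//.
  apply: le_Rintegral => //; first exact: integrable_scale.
    by have [] := cintegrableZ (npBO_symbol mu (- tau) xi) measurableT iFF.
  move=> eta _; rewrite /F /free_flow cl symbol_triple.
  have B0 : 0 <= tent M (xi - eta) * tent M eta by rewrite mulr_ge0 ?tent_ge0.
  rewrite mulrC [leRHS]mulrC.
  have [->|Bn] := eqVneq (tent M (xi - eta) * tent M eta) 0.
    by rewrite !mul0r.
  have [be1 be2] : tent M (xi - eta) != 0 /\ tent M eta != 0.
    by move: Bn; rewrite mulf_eq0 negb_or => /andP[].
  rewrite ler_wpM2l//.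
  have x01 : 0 <= `|xi| <= 1 by rewrite normr_ge0 ger0_norm; lra.
  have [d1 d2 d3] :=
    high_high_dissipation M4 x01 (tent_support be1) (tent_support be2).
  apply: oscillating_lower_bound => //.
  - by rewrite -mulrA ler_wpM2l// ltW.
  - have -> : 5 * mu * M ^+ 3 = mu * (5 * M ^+ 3) by ring.
    by rewrite ler_wpM2l// ltW.
  - have nn (z : R) : `|z * `|z| | = `|z| ^+ 2.
      by rewrite normrM normr_id expr2.
    apply: le_trans (ler_normB _ _) _; rewrite nn.
    apply: le_trans d3; rewrite lerD2r.
    by apply: le_trans (ler_normD _ _) _; rewrite !nn.
have hd := integral_damping hM.
have cd : continuous (damping M).
  have ce (a : R) : continuous (fun tau => expR (- a * tau)).
    apply: continuous_expR_comp => y.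
    by apply: cvgM; [exact: cvg_cst|exact: cvg_id].
  move=> y; apply: cvgB; first exact: ce.
  by apply: cvgM; [exact: cvg_cst|exact: ce].
have id := @continuous_integrable_itv _ _ 0 t cd.
have ReI : 8^-1 * (20 * mu * M ^+ 3)^-1 <= normc (cintegral `[0, t] W).
  apply: le_trans (le_trans (ler_norm _) (Re_le_normc _)) => /=.
  apply: (@le_trans _ _ (\int[mu1]_(tau in `[0, t]) (G * damping M tau))).
    rewrite RintegralZl//; apply: ler_pM => //.
    by rewrite invr_ge0 ltW// !mulr_gt0.
  apply: le_Rintegral => //; first exact: integrable_scale.
  by case: iW.
have m1 : 1 <= normc (npBO_symbol mu t xi).
  rewrite normc_symbol -[leLHS]expR0 ler_expR !mulr_ge0 ?(ltW mu0) ?(ltW t0)//.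
  rewrite subr_ge0 -[leRHS]expr1 ler_wiXn2l// ger0_norm; lra.
have k8 : (2 * pi)^-1 / 8 <= (2 * pi)^-1 * (xi / 2).
  by rewrite ler_wpM2l ?(ltW pi2)//; lra.
have k80 : 0 <= (2 * pi)^-1 / 8 :> R by rewrite divr_ge0// ltW.
have -> : interaction_cst / M ^+ 3 =
    1 * ((2 * pi)^-1 / 8) * (8^-1 * (20 * mu * M ^+ 3)^-1).
  rewrite /interaction_cst; move: (@pi R) (pi_gt0 R) => q q0.
  by field; rewrite !gt_eqF.
apply: ler_pM => //.
- by rewrite mul1r.
- by rewrite mulr_ge0// invr_ge0 ltW// !mulr_gt0.
- by apply: ler_pM.
Qed.

Lemma second_iterate_norm M s : s <= 0 -> threshold <= M ->
  (2 `^ s) / 4 * (interaction_cst / M ^+ 3) ^+ 2 <=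
  fine (Hs_norm s (duhamel mu T (free_flow mu T (tent_datum M))
    (free_flow mu T (tent_datum M)) t)) ^+ 2.
Proof.
move=> s0 hM.
have M0 : 0 < M by have := le_trans threshold_ge4 hM; lra.
have [b pb] := @profile_tent R M (ltW M0).
have low xi := @low_frequency_lower_bound M xi hM.
set S := duhamel mu T _ _ in low *.
have fF := decaying_free_flow mu0 T0 pb.
have fS := decaying_duhamel mu0 T0 fF fF; rewrite -/S in fS.
have [bS cS _ _] := fS.
have ie := decay_bound_integrable s (ccont_measurable (cS t)) (bS t).
have fE (x : R) : fine x%:E = x by [].
rewrite (Hs_norm_sqrt ie) fE sqr_sqrtr; last first.
  by apply: Rintegral_ge0 => x _; exact: sqr_ge0.
set k := interaction_cst / M ^+ 3 in low *.
have k0 : 0 <= k.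
  rewrite /k /interaction_cst !mulr_ge0 ?invr_ge0 ?exprn_ge0 ?(ltW M0)//.
    by rewrite mulr_ge0// pi_ge0.
  by rewrite mulr_ge0// ltW.
pose A : set R := `[1 / 4, 1 / 2]%classic.
have iI : mu1.-integrable setT (EFin \o (\1_A : R -> R)).
  exact: integrable_indic_itv.
have -> : 2 `^ s / 4 * k ^+ 2 =
    \int[mu1]_xi (2 `^ s * k ^+ 2 * (\1_A xi : R)).
  by rewrite RintegralZl// /A Rintegral_indic_itv; [field|lra].
apply: le_Rintegral => //; first exact: integrable_scale.
move=> xi _; rewrite indicE.
case: (boolP (xi \in _)) => [|_]; last by rewrite mulr0 sqr_ge0.
rewrite inE /A/= in_itv/= => xi12; have /andP[x1 x2] := xi12; rewrite mulr1.
rewrite [leRHS]exprMn sqr_sobolev_weight.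
apply: ler_pM; rewrite ?powR_ge0 ?sqr_ge0//.
- rewrite -(opprK s) 2!(powRN _ (- s)) lef_pV2 ?posrE ?powR_gt0//; last first.
    by rewrite ltr_wpDr// sqr_ge0.
  apply: ge0_ler_powR; rewrite ?nnegrE ?oppr_ge0 ?addr_ge0 ?sqr_ge0//.
  have : xi ^+ 2 <= 1 by rewrite expr_le1//; lra.
  lra.
- by rewrite lerXn2r ?nnegrE ?normc_ge0// low.
Qed.

End LowerBound.

Theorem theorem1p4 (R : realType) (realv : bool) (mu s T : R)
    (D : set (R -> R[i])) (X : set (R -> R -> R[i]))
    (Phi : (R -> R[i]) -> R -> R -> R[i]) :
  0 < mu -> s < - (3 / 2) -> 0 < T ->
  Hs_open realv s D -> D (fun=> 0) ->
  flow_map realv mu s T D X Phi ->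
  forall t : R, 0 < t <= T -> ~ C2_on realv s D (fun phi => Phi phi t).
Proof.
move=> mu0 s32 T0 oD D0 fl t /andP[t0 tT] C2.
have [|C C0 hC] := C2_bounds_second_iterate mu0 (ltW T0) oD D0 fl _ C2.
  by rewrite ltW.
have s0 : s <= 0 by lra.
pose p : R := - (2 * s) - 3; have p0 : 0 < p by rewrite /p; lra.
pose c1 : R := 2 `^ s / 4 * interaction_cst mu ^+ 2.
have ic0 : 0 < interaction_cst mu.
  rewrite /interaction_cst !mulr_gt0 ?invr_gt0 ?mulr_gt0//.
  exact: pi_gt0.
have c10 : 0 < c1 by rewrite /c1 mulr_gt0 ?divr_gt0 ?powR_gt0 ?exprn_gt0.
pose c2 : R := (C * (4 * 4 `^ (- s))) ^+ 2.
pose L := c2 / c1 + 1.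
have L0 : 0 < L by rewrite ltr_wpDl// divr_ge0 ?sqr_ge0 ?ltW.
(* The frequency at which [c1 M ^ -6 <= c2 M ^ (4 s)] fails, that is
   [M ^ (2 p) > c2 / c1]. *)
pose M := Num.max (threshold mu t) (L `^ (2 * p)^-1).
have hM : threshold mu t <= M by rewrite le_max lexx.
have hM2 : L `^ (2 * p)^-1 <= M by rewrite le_max lexx orbT.
have M2 : 2 <= M by have := le_trans (threshold_ge4 mu0 t0) hM; lra.
have M0 : 0 < M by lra.
have LM : L <= M `^ (2 * p).
  have p20 : 2 * p != 0 by rewrite gt_eqF// mulr_gt0.
  have -> : L = (L `^ (2 * p)^-1) `^ (2 * p).
    by rewrite -powRrM mulVf// powRr1// ltW.
  by apply: ge0_ler_powR; rewrite ?nnegrE ?powR_ge0 ?(ltW M0) ?mulr_ge0 ?(ltW p0).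
have [b pb] := @profile_tent R M (ltW M0).
have low := second_iterate_norm mu0 t0 tT s0 hM.
have up := hC _ _ pb.
have nh := Hs_norm_tent s0 M2.
have n0 (f : R -> R[i]) : 0 <= fine (Hs_norm s f) by rewrite fine_ge0// Hs_norm_ge0.
have up2 := le_trans up (ler_wpM2l C0 nh).
have up3 : fine (Hs_norm s (duhamel mu T (free_flow mu T (tent_datum M))
    (free_flow mu T (tent_datum M)) t)) ^+ 2 <= c2 * (M `^ (2 * s)) ^+ 2.
  rewrite /c2 -exprMn lerXn2r ?nnegrE ?mulr_ge0 ?powR_ge0//.
  apply: le_trans up2 _.
  have -> : (M ^+ 2 / 4) `^ s = 4 `^ (- s) * M `^ (2 * s).
    rewrite powRM ?sqr_ge0 ?invr_ge0// -(@powR_inv1 _ 4)// -powRrM mulN1r mulrC.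
    by rewrite -(@powR_mulrn _ M 2) ?(ltW M0)// -powRrM.
  by rewrite le_eqVlt; apply/orP; left; apply/eqP; ring.
have {up3}low := le_trans low up3.
have M30 : 0 < M ^+ 3 by rewrite exprn_gt0.
have Mp : (M `^ (2 * s)) ^+ 2 * M `^ (2 * p) = (M ^+ 3)^-1 ^+ 2.
  transitivity (M `^ (- 6)).
    rewrite -(@powR_mulrn _ (M `^ (2 * s)) 2) ?powR_ge0// -powRrM -powRD.
      by congr powR; rewrite /p; ring.
    by rewrite (gt_eqF M0) implybT.
  by rewrite powRN powR_mulrn ?(ltW M0)// exprVn -exprM.
have e : 2 `^ s / 4 * (interaction_cst mu / M ^+ 3) ^+ 2 = c1 * (M ^+ 3)^-1 ^+ 2.
  by rewrite /c1 exprMn; ring.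
rewrite e -Mp in low.
have P0 : 0 < (M `^ (2 * s)) ^+ 2 by rewrite exprn_gt0// powR_gt0.
have : c1 * M `^ (2 * p) <= c2.
  by rewrite -(ler_pM2r P0); lra.
move=> /(le_trans (ler_wpM2l (ltW c10) LM)).
rewrite /L mulrDr mulr1 mulrCA divff ?gt_eqF// mulr1.
by apply/negP; rewrite -ltNge ltrDl.
Qed.
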